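(* Let $d=1$ and let $F_0=\mathcal{N}(\mu,\sigma^2)$ with $\mu\in\mathbb{R}$, $\sigma>0$. Let $\tilde x_1,\dots,\tilde x_n\in\mathbb{R}$ ($n\ge1$ finite) be the minority-class points with mean $\bar x=\frac1n\sum_{j=1}^n\tilde x_j$ and $\sup_{N>0}\max_{1\le j\le n}|\tilde x_j|<C<+\infty$, and let $x_1,x_2,\dots$ be i.i.d. samples from $F_0$. Assume that $\int e^{\beta x}(1+|x|^k)\,dF_0(x)<+\infty$ for all $\beta\in\mathbb{R}$ and $1\le k\le2$, that $F_0$ surrounds $\bar x$ (see context), and that $\mathbb{E}_{F_0}[e^{\beta_*X}(X-\bar x)^2]>0$, where $\beta_*$ is the unique solution of $\int e^{\beta_*x}x\,dF_0(x)\big/\int e^{\beta_*x}\,dF_0(x)=\bar x$. Let $(\alpha_N,\beta_N)$ be the maximizer of the centered log-likelihood $\mathcal{L}_N$ (see context). Then the asymptotic variance $\Sigma$ in the limit $\sqrt N(\beta_N-\beta_* )\overset{\mathcal D}{\to}\mathcal{N}(0,\Sigma)$ as $N\to+\infty$, namely $$\Sigma=\frac{\int e^{2\beta_*x}(x-\bar x)^2\,dF_0(x)}{\left(\int e^{\beta_*x}(x-\bar x)^2\,dF_0(x)\right)^2},$$ is the scalar $$\sigma_{\bar x,\mu}^2=e^{\frac{(\bar x-\mu)^2}{\sigma^2}}\left[\frac{(\bar x-\mu)^2+\sigma^2}{\sigma^4}\right].$$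
   Context: The number $n$ and the minority-class points $\tilde x_j$ (observations with $y=1$) are fixed; the majority-class observations ($y=0$) are the first $N$ terms of the i.i.d. sequence $(x_i)$ from $F_0$. $\mathbb{E}_{F_0}$ is expectation of a function of $X\sim F_0$, and $\overset{\mathcal D}{\to}$ is convergence in distribution. The centered logistic-regression log-likelihood is $$\mathcal{L}_N(\alpha,\beta)=n\alpha-\sum_{j=1}^n\log\big(1+e^{\alpha+\beta(\tilde x_j-\bar x)}\big)-\sum_{i=1}^N\log\big(1+e^{\alpha+\beta(x_i-\bar x)}\big),\qquad\alpha,\beta\in\mathbb{R}.$$ Its maximizer exists and is unique almost surely for all sufficiently large $N$; for other $N$ (and samples), $\beta_N$ may be defined arbitrarily. $F_0$ surrounds $\bar x$ if there exist $\epsilon>0$, $\delta>0$ such that $\inf_{\omega\in\{-1,1\}}F_0(\{x:(x-\bar x)\omega>\epsilon\})>\delta$. *)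

(* Defs.v *)
From HB Require Import structures.
From mathcomp Require Import all_boot all_order all_algebra.
From mathcomp Require Import all_classical all_reals all_analysis.

Set Implicit Arguments.
Unset Strict Implicit.
Unset Printing Implicit Defensive.

Import Order.TTheory GRing.Theory Num.Theory.
Import numFieldNormedType.Exports.

Local Open Scope classical_set_scope.
Local Open Scope ring_scope.

Definition mutually_independent (d : measure_display) (T : measurableType d)
    (R : realType) (P : probability T R) (X : nat -> {RV P >-> R}) : Prop :=
  forall (s : seq nat) (B : nat -> set R),
    uniq s -> (forall i, measurable (B i)) ->
    (P (\bigcap_(i in [set` s]) (X i @^-1` B i)) =
       \prod_(i <- s) P (X i @^-1` B i))%E.

Definition iid_from (d : measure_display) (T : measurableType d)
    (R : realType) (P : probability T R) (X : nat -> {RV P >-> R})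
    (F0 : probability (measurableTypeR R) R) : Prop :=
  mutually_independent X /\
  forall (i : nat) (B : set R), measurable B -> distribution P (X i) B = F0 B.

Definition cvg_in_distribution (d : measure_display) (T : measurableType d)
    (R : realType) (P : probability T R) (X : nat -> T -> R)
    (Q : probability (measurableTypeR R) R) : Prop :=
  (forall N, measurable_fun [set: T] (X N)) /\
  forall f : R -> R, continuous f -> (exists M : R, forall x, `|f x| <= M) ->
    ('E_P[f \o X N] @[N --> \oo] --> 'E_Q[f])%E.

Definition surrounds (R : realType) (F0 : probability (measurableTypeR R) R)
    (xbar : R) : Prop :=
  exists eps delta : R, [/\ 0 < eps, 0 < delta &
    (delta%:E <
       ereal_inf ([set F0 [set x : R | eps < (x - xbar) * omega]
                    | omega in [set -1; 1 : R]])%R)%E].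

Definition sample_mean (R : realType) (n : nat) (xt : 'I_n -> R) : R :=
  (\sum_(j < n) xt j) / n%:R.

(* The minority points are [xt], the majority points are [x 0, ..., x N.-1],
   and the argument is the pair (alpha, beta). *)
Definition centered_loglik (R : realType) (n : nat) (xt : 'I_n -> R)
    (N : nat) (x : nat -> R) (ab : R * R) : R :=
  let xbar := sample_mean xt in
  n%:R * ab.1
  - \sum_(j < n) ln (1 + expR (ab.1 + ab.2 * (xt j - xbar)))
  - \sum_(i < N) ln (1 + expR (ab.1 + ab.2 * (x i - xbar))).

Definition maximizes (R : realType) (L : R * R -> R) (ab : R * R) : Prop :=
  forall ab' : R * R, L ab' <= L ab.

Definition tilted_mean (R : realType) (F0 : probability (measurableTypeR R) R)
    (b : R) : R :=
  (\int[F0]_x (expR (b * x) * x)) / (\int[F0]_x expR (b * x)).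

Definition asymptotic_variance (R : realType)
    (F0 : probability (measurableTypeR R) R) (b xbar : R) : R :=
  (\int[F0]_x (expR (2 * b * x) * (x - xbar) ^+ 2)) /
  (\int[F0]_x (expR (b * x) * (x - xbar) ^+ 2)) ^+ 2.

(* Main.v *)
Require Import Defs.
From HB Require Import structures.
From mathcomp Require Import all_boot all_order all_algebra.
From mathcomp Require Import all_classical all_reals all_analysis.
From mathcomp Require Import measurable_realfun ring lra.

Set Implicit Arguments.
Unset Strict Implicit.
Unset Printing Implicit Defensive.

Import Order.TTheory GRing.Theory Num.Theory.
Import numFieldNormedType.Exports.

Local Open Scope classical_set_scope.
Local Open Scope ring_scope.

(** Why the estimator is asymptotically normal.

    Write z for a majority observation minus the minority mean, and A for the
    exponential of the intercept.  For a fixed slope b the intercept equation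
    determines A, and the convexity of y |-> A / (y + A) (an inequality between
    arithmetic and harmonic means) forces A = O(1/N)
    ([profile_equation], [profile_exists]).  Hence the denominators 1 + A w of
    the slope equation are negligible, and so are the finitely many minority
    terms: with b_0 the limit slope, the slope score at b = b_0 + t / sqrt N is
    - A times
      sum_i z_i e^{b_0 z_i} + (t / sqrt N) sum_i z_i^2 e^{b_0 z_i} + O(1),
    uniformly over bounded t ([profile_score_expansion]).  The log-likelihood is
    concave, so the sign of the slope score at one point of the profile curve
    tells on which side of b the maximizer lies ([maximizer_score_sign]).
    Evaluating at t = W - eta and t = W + eta, with
      W = - sum_i z_i e^{b_0 z_i} / (J sqrt N),  J = E[z^2 e^{b_0 z}],
    traps sqrt N (b_N - b_0) within eta of W ([maximizer_near]).  The same bounds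
    on empirical means force both signs among the z_i, which makes the maximizer
    exist and be unique ([maximizer_exists_unique]).  All this is deterministic,
    on an event described by three empirical means; Chebyshev's inequality makes
    that event likely ([bad_event_small]).

    The variable W is a normalized sum of i.i.d. centered variables, and its
    central limit theorem is Lindeberg's exchange argument in operator form:
    averaging a test function over one summand and over a Gaussian of the same
    variance agree up to the third moments, and both averagings are contractions
    ([lindeberg_sum]).  Gaussian averagings compose into one because densities
    convolve ([gauss_op_comp]).  This gives convergence for test functions with
    a controlled third-order Taylor remainder ([clt_smooth]); a continuous
    bounded function is uniformly close to such a function on a compact
    interval, by taking third difference quotients of a third antiderivative
    ([smooth_approx]), and second moments control what happens outside.

    Finally, tilting N(m, s^2) by e^{b u} gives N(m + s^2 b, s^2) up to a factor
    ([normal_pdf_tilt]).  So b_0 = (xbar - mu) / sigma^2, and the two integrals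
    of the variance formula are explicit ([normal_asymptotic_variance]). *)

(** * Taylor bounds and smooth approximation *)

Lemma mean_value_bound (R : realType) (f df : R -> R) (x y B : R) :
  (forall t : R, is_derive t 1 f (df t)) ->
  (forall t, `|t - x| <= `|y - x| -> `|df t| <= B) ->
  `|f y - f x| <= B * `|y - x|.
Proof.
move=> fd dB.
have cf : continuous f.
  by move=> t; apply/differentiable_continuous/derivable1_diffP; case: (fd t).
case: (leP x y) => xy.
  have [c] := MVT_segment xy (fun t _ => fd t) (continuous_subspaceT cf).
  rewrite in_itv/= => /andP[xc cy] ->; rewrite normrM ler_wpM2r//.
  by apply: dB; rewrite !ger0_norm ?subr_ge0// lerD2r.
have [c] := MVT_segment (ltW xy) (fun t _ => fd t) (continuous_subspaceT cf).
rewrite in_itv/= => /andP[xc cy]; rewrite -normrN opprB => ->.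
rewrite normrM (distrC y) ler_wpM2r//.
apply: dB; rewrite !(distrC _ x) !ger0_norm ?subr_ge0 ?(ltW xy)//.
by rewrite lerD2l lerN2.
Qed.

(** This bound and the next two integrate e^t <= e^|y| once, twice and three
    times. *)
Lemma expR_taylor1 (R : realType) (y : R) : `|expR y - 1| <= `|y| * expR `|y|.
Proof.
have /(_ (fun t => is_derive_expR t)) := @mean_value_bound R expR expR 0 y (expR `|y|).
rewrite !subr0 expR0 mulrC; apply => t; rewrite subr0 => ty.
by rewrite ger0_norm ?expR_ge0// ler_expR; apply: le_trans ty; exact: ler_norm.
Qed.

Lemma expR_taylor2 (R : realType) (y : R) :
  `|expR y - 1 - y| <= `|y| ^+ 2 * expR `|y|.
Proof.
have H (t : R) : is_derive t 1 (fun t => expR t - 1 - t) (expR t - 1).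
  by apply: is_derive_eq; rewrite subr0.
have := mean_value_bound (B := `|y| * expR `|y|) (y := y) H.
move=> /(_ 0); rewrite !subr0 expR0 subrr subr0 => h.
rewrite expr2 mulrAC; apply: h => t.
rewrite subr0 => ty; apply: (le_trans (expR_taylor1 t)).
by rewrite ler_pM// ?expR_ge0// ler_expR.
Qed.

Lemma expR_taylor3 (R : realType) (y : R) :
  `|expR y - 1 - y - y ^+ 2 / 2| <= `|y| ^+ 3 * expR `|y|.
Proof.
have H (t : R) : is_derive t 1 (fun t => expR t - 1 - t - t ^+ 2 / 2)
    (expR t - 1 - t).
  by apply: is_derive_eq; rewrite /GRing.scale/= ; field.
have := mean_value_bound (B := `|y| ^+ 2 * expR `|y|) (y := y) H.
move=> /(_ 0); rewrite !subr0 expR0 subrr expr0n/= mul0r !subr0 => h.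
rewrite (_ : _ * _ = `|y| ^+ 2 * expR `|y| * `|y|); last by ring.
apply: h => t.
rewrite subr0 => ty; apply: (le_trans (expR_taylor2 t)).
by rewrite ler_pM// ?expR_ge0 ?ler_expR// lerXn2r ?nnegrE.
Qed.

(** Vanishing to the left of [a] makes the construction iterable, and lets the
    integral over a half-open range be replaced by one starting at [a - 1]: the
    derivative is then computed by the fundamental theorem to the right of [a - 1]
    and is 0 near every point to the left of [a]. *)
Lemma antiderivative (R : realType) (h : R -> R) (a : R) :
  continuous h -> (forall x, x <= a -> h x = 0) ->
  exists H : R -> R, (forall x : R, is_derive x 1 H (h x)) /\
    (forall x, x <= a -> H x = 0).
Proof.
move=> ch h0.
pose H (y : R) := (\int[lebesgue_measure]_(t in `[a - 1, y]) h t).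
have Ha y : y <= a -> H y = 0.
  move=> ya; rewrite /H (@eq_Rintegral _ _ _ _ _ (cst 0)).
    by rewrite Rintegral_cst// mul0r.
  by move=> t; rewrite inE/= in_itv/= => /andP[_ ty]; rewrite h0// (le_trans ty).
exists H; split => // x.
case: (ltP (a - 1) x) => ax.
  have I : lebesgue_measure.-integrable `[a - 1, x + 1] (EFin \o h).
    apply: continuous_compact_integrable; first exact: segment_compact.
    exact: continuous_subspaceT.
  have x1 : x < x + 1 by rewrite ltrDl.
  have [dH H'] := continuous_FTC1_closed x1 I ax (ch x).
  by apply: DeriveDef; [exact: dH | rewrite -derive1E; exact: H'].
have nH : \forall y \near x, cst 0 y = H y.
  near=> y; symmetry; apply: Ha; near: y.
  by apply: lt_le_nbhsl; rewrite (le_lt_trans ax)// ltrBlDr ltrDl.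
rewrite h0; last by rewrite (le_trans ax)// lerBlDr lerDl.
by apply: (near_eq_is_derive (f := cst 0)).
Unshelve. all: by end_near. Qed.

Lemma segment_unif_continuous (R : realType) (g : R -> R) (a b e : R) :
  continuous g -> 0 < e ->
  exists2 d, 0 < d & forall x y, a <= x <= b -> `|x - y| <= d ->
    `|g x - g y| <= e.
Proof.
move=> cg e0.
have [+ _] := compact_near_coveringP `[a, b]%classic.
move=> /(_ (@segment_compact _ a b)) /(_ R (0:R)^'+
  (fun d x => forall y, `|x - y| <= d -> `|g x - g y| <= e)) NC.
have H : \forall d \near (0:R)^'+, `[a, b]%classic `<=`
   (fun x => forall y, `|x - y| <= d -> `|g x - g y| <= e).
  apply: NC => x _.
  have e20 : 0 < e / 2 by rewrite divr_gt0.
  have /cvgrPdist_lt/(_ _ e20) := cg x.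
  move=> /nbhs_ballP[r/= r0 hr].
  have r20 : 0 < r / 2 by rewrite divr_gt0.
  exists (ball x (r / 2), [set d | d < r / 2]).
    split => /=; first exact: nbhsx_ballx.
    exact: nbhs_right_lt.
  move=> [x' d]/= [xx' dr] y x'y.
  have h1 : `|g x - g x'| < e / 2.
    by apply: hr; apply: le_ball xx'; lra.
  have h2 : `|g x - g y| < e / 2.
    apply: hr; rewrite -ball_normE /= in xx' *.
    by rewrite (le_lt_trans (ler_distD x' _ _))// [ltRHS]splitr ltrD// (le_lt_trans x'y).
  rewrite (le_trans (ler_distD (g x) _ _))// [leRHS]splitr lerD ?(ltW h2)//.
  by rewrite distrC ltW.
have [d []] := filter_ex (filterI H (nbhs_right_gt (0:R))).
by move=> hd d0; exists d => // x y xab; apply: hd; rewrite /= in_itv.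
Qed.

Definition diffq (R : realType) (e : R) (F : R -> R) : R -> R :=
  fun x => (F (x + e) - F x) / e.

Lemma is_derive_diffq (R : realType) (e : R) (F f : R -> R) :
  (forall x : R, is_derive x 1 F (f x)) ->
  forall x : R, is_derive x 1 (diffq e F) (diffq e f x).
Proof.
move=> Ff x.
have H : is_derive x 1 (F \o (fun y => y + e)) (f (x + e) * 1).
  have S := is_derive_shift x 1 e.
  by have := Ff (x + e) => FS; exact: is_derive1_comp.
rewrite mulr1 in H.
have -> : diffq e F = (e^-1) *: ((F \o (fun y => y + e)) - F).
  by apply/funext => y; rewrite /diffq mulrC.
by apply: is_derive_eq; rewrite /diffq/= mulrC.
Qed.

(** This is what keeps difference quotients of antiderivatives bounded by, and close
    to, the original function, whatever the growth of the antiderivatives. *)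
Lemma diffq_mvt (R : realType) (e : R) (F f : R -> R) (x : R) : 0 < e ->
  (forall x : R, is_derive x 1 F (f x)) ->
  exists2 c, x <= c <= x + e & diffq e F x = f c.
Proof.
move=> e0 Ff.
have cF : continuous F.
  by move=> t; apply/differentiable_continuous/derivable1_diffP; case: (Ff t).
have xe : x <= x + e by rewrite lerDl ltW.
have [c] := MVT_segment xe (fun t _ => Ff t) (continuous_subspaceT cF).
rewrite in_itv/= => cx E; exists c => //.
by rewrite /diffq E addrAC subrr add0r mulfK// gt_eqF.
Qed.

Lemma diffq_bound (R : realType) (e M : R) (F : R -> R) : 0 < e ->
  (forall x, `|F x| <= M) -> forall x, `|diffq e F x| <= M * (2 / e).
Proof.
move=> e0 FM x; have ei : 0 <= e^-1 by rewrite invr_ge0 ltW.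
rewrite /diffq normrM (ger0_norm ei) mulrA ler_wpM2r//.
by apply: le_trans (ler_normB _ _) _; have := FM x; have := FM (x + e); lra.
Qed.

Definition bounded_lipschitz (R : realType) (K : R) (f : R -> R) :=
  (forall x, `|f x| <= K) /\ (forall x y, `|f y - f x| <= K * `|y - x|).

(** The test functions of the exchange argument.  Only the Taylor expansion matters,
    so [f1] and [f2] are not required to be derivatives; this makes stability under
    averaging of translates immediate.  The Lipschitz bounds are there because they
    pass to averages and make all these functions measurable. *)
Definition smooth3 (R : realType) (K : R) (f f1 f2 : R -> R) :=
  [/\ bounded_lipschitz K f, bounded_lipschitz K f1, bounded_lipschitz K f2 & forall x y,
    `|f (x + y) - f x - f1 x * y - f2 x * y ^+ 2 / 2| <= K * `|y| ^+ 3].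

Lemma smooth3_derive (R : realType) (K : R) (f f1 f2 f3 : R -> R) :
  (forall x : R, is_derive x 1 f (f1 x)) ->
  (forall x : R, is_derive x 1 f1 (f2 x)) ->
  (forall x : R, is_derive x 1 f2 (f3 x)) ->
  (forall x, `|f x| <= K) -> (forall x, `|f1 x| <= K) ->
  (forall x, `|f2 x| <= K) -> (forall x, `|f3 x| <= K) ->
  smooth3 K f f1 f2.
Proof.
move=> d1 d2 d3 b0 b1 b2 b3.
have K0 : 0 <= K := le_trans (normr_ge0 _) (b0 0).
split.
- by split => // x y; exact: mean_value_bound d1 _.
- by split => // x y; exact: mean_value_bound d2 _.
- by split => // x y; exact: mean_value_bound d3 _.
move=> x y.
have T1 z : `|f1 z - f1 x - f2 x * (z - x)| <= K * `|z - x| ^+ 2.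
  have D (t : R) : is_derive t 1 (fun t => f1 t - f1 x - f2 x * (t - x))
      (f2 t - f2 x).
    by apply: is_derive_eq; rewrite /GRing.scale/=; ring.
  have -> : f1 z - f1 x - f2 x * (z - x) =
    (f1 z - f1 x - f2 x * (z - x)) - (f1 x - f1 x - f2 x * (x - x)) by ring.
  have -> : K * `|z - x| ^+ 2 = K * `|z - x| * `|z - x| by ring.
  apply: (mean_value_bound D) => t tx.
  apply: (le_trans (mean_value_bound (B := K) d3 _)) => //.
  by rewrite ler_wpM2l.
have D (t : R) : is_derive t 1
    (fun t => f t - f x - f1 x * (t - x) - f2 x * (t - x) ^+ 2 / 2)
    (f1 t - f1 x - f2 x * (t - x)).
  by apply: is_derive_eq; rewrite /GRing.scale/=; field.
have -> : f (x + y) - f x - f1 x * y - f2 x * y ^+ 2 / 2 =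
    (f (x + y) - f x - f1 x * (x + y - x) - f2 x * (x + y - x) ^+ 2 / 2) -
    (f x - f x - f1 x * (x - x) - f2 x * (x - x) ^+ 2 / 2) by field.
have -> : K * `|y| ^+ 3 = K * `|y| ^+ 2 * `|x + y - x|.
  by rewrite addrAC subrr add0r; ring.
apply: (mean_value_bound D) => t; rewrite (addrAC x) subrr add0r => tx.
apply: (le_trans (T1 t)).
by rewrite ler_wpM2l// lerXn2r ?nnegrE.
Qed.

(** With H a third antiderivative of h, the third difference quotient of H is a
    value of h at a nearby point, so it is uniformly close to h where h is uniformly
    continuous; its derivatives are difference quotients of bounded functions.  The
    function h is g frozen to the left of - m - 1 and shifted to vanish there, so
    that its antiderivatives exist on the whole line. *)
Lemma smooth_approx (R : realType) (g : R -> R) (M m e : R) :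
  continuous g -> (forall x, `|g x| <= M) -> 0 < m -> 0 < e ->
  exists K f f1 f2 d, [/\ smooth3 K f f1 f2, 0 < d, forall x, `|f x| <= M &
    forall w x, `|w| <= m -> `|x - w| <= d -> `|g x - f w| <= e].
Proof.
move=> cg gM m0 e0.
have [d0 d00 hd0] := @segment_unif_continuous R g (- m - 1) (m + 1) e cg e0.
pose d := Num.min d0 1.
have d_gt0 : 0 < d by rewrite lt_min d00 ltr01.
have d1 : d <= 1 by rewrite ge_min lexx orbT.
have dd0 : d <= d0 by rewrite ge_min lexx.
pose a := - m - 1.
pose h x := g (Num.max x a) - g a.
have ch : continuous h.
  move=> x; apply: continuousB; last exact: cvg_cst.
  apply: (@continuous_comp _ _ _ (fun x => Num.max x a) g); last exact: cg.
  exact: (@continuous_max _ _ id (cst a) x (@cvg_id _ _) (@cvg_cst _ _ _ _ _)).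
have h0 x : x <= a -> h x = 0 by move=> xa; rewrite /h max_r// subrr.
have [H1 [dH1 H10]] := antiderivative ch h0.
have cH1 : continuous H1.
  by move=> t; apply/differentiable_continuous/derivable1_diffP; case: (dH1 t).
have [H2 [dH2 H20]] := antiderivative cH1 H10.
have cH2 : continuous H2.
  by move=> t; apply/differentiable_continuous/derivable1_diffP; case: (dH2 t).
have [H3 [dH3 H30]] := antiderivative cH2 H20.
(* three steps of length ep stay within half of the continuity scale *)
pose ep := d / 6.
have ep0 : 0 < ep by rewrite divr_gt0.
have dD := is_derive_diffq ep.
have M0 : 0 <= M := le_trans (normr_ge0 _) (gM 0).
have hM x : `|h x| <= M + M by rewrite (le_trans (ler_normB _ _))// lerD.
have mean1 x : exists2 c, x <= c <= x + ep & diffq ep H1 x = h c by exact: diffq_mvt.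
have mean2 x : exists2 c, x <= c <= x + 2 * ep & diffq ep (diffq ep H2) x = h c.
  have [c cx ->] := diffq_mvt x ep0 (dD _ _ dH2).
  by have [c' cx' ->] := mean1 c; exists c' => //; lra.
have mean3 x : exists2 c, x <= c <= x + 3 * ep & diffq ep (diffq ep (diffq ep H3)) x = h c.
  have [c cx ->] := diffq_mvt x ep0 (dD _ _ (dD _ _ dH3)).
  by have [c' cx' ->] := mean2 c; exists c' => //; lra.
pose q := 2 / ep.
have q0 : 0 <= q by rewrite divr_ge0 ?ltW.
pose M2 := M + M.
have M20 : 0 <= M2 by rewrite addr_ge0.
pose K := M + M2 * q + M2 * q * q + M2 * q * q * q.
have K1 : 0 <= M2 * q by rewrite mulr_ge0.
have K2 : 0 <= M2 * q * q by rewrite mulr_ge0.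
have K3 : 0 <= M2 * q * q * q by rewrite mulr_ge0.
pose f x := diffq ep (diffq ep (diffq ep H3)) x + g a.
have fM x : `|f x| <= M.
  by have [c _ E] := mean3 x; rewrite /f E /h subrK.
pose f1 := diffq ep (diffq ep (diffq ep H2)).
pose f2 := diffq ep (diffq ep (diffq ep H1)).
have df (x : R) : is_derive x 1 f (f1 x).
  have dx := dD _ _ (dD _ _ (dD _ _ dH3)) x.
  by rewrite /f; apply: is_derive_eq; rewrite addr0.
have df1 (x : R) : is_derive x 1 f1 (f2 x).
  exact: (dD _ _ (dD _ _ (dD _ _ dH2)) x).
have df2 (x : R) : is_derive x 1 f2 (diffq ep (diffq ep (diffq ep h)) x).
  exact: (dD _ _ (dD _ _ (dD _ _ dH1)) x).
have fK x : `|f x| <= K by rewrite (le_trans (fM x))// /K; lra.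
have f1K x : `|f1 x| <= K.
  apply: (@le_trans _ _ (M2 * q)); last by rewrite /K; lra.
  by apply: diffq_bound => // y; have [c _ ->] := mean2 y.
have f2K x : `|f2 x| <= K.
  apply: (@le_trans _ _ (M2 * q * q)); last by rewrite /K; lra.
  apply: diffq_bound => // {}x; apply: diffq_bound => // y.
  by have [c _ ->] := mean1 y.
have f3K x : `|diffq ep (diffq ep (diffq ep h)) x| <= K.
  apply: (@le_trans _ _ (M2 * q * q * q)); last by rewrite /K; lra.
  by do 3 apply: diffq_bound => // {}x.
exists K, f, f1, f2, (d / 2); split.
- exact: smooth3_derive df df1 df2 fK f1K f2K f3K.
- by rewrite divr_gt0.
- exact: fM.
- move=> w x wm xw; have [c cx E] := mean3 w.
  have {}cx : w <= c <= w + d / 2.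
    by move: cx; rewrite (_ : 3 * ep = d / 2)//; rewrite /ep; field.
  rewrite /f E /h subrK.
  have wm' := ler_norm w; have wm2 := ler_norm (- w); rewrite normrN in wm2.
  have xw1 := ler_norm (x - w); have xw2 := ler_norm (- (x - w)).
  rewrite normrN in xw2.
  rewrite max_l; last by rewrite /a; lra.
  by apply: hd0; [|rewrite ler_norml]; lra.
Qed.

(** * Gaussian integrals *)

Lemma Rintegral_prob_cst (d : measure_display) (T : measurableType d)
  (R : realType) (P : probability T R) (k : R) : \int[P]_x k = k.
Proof. by rewrite Rintegral_cst//= probability_setT mulr1. Qed.

Section normal.
Context {R : realType}.
Local Notation mu := (@lebesgue_measure R).
Local Notation N := (@normal_prob R).

Lemma ge0_integral_normal_prob (m s : R) (f : R -> \bar R) :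
  measurable_fun [set: R] f -> (forall x, 0 <= f x)%E ->
  (\int[N m s]_x f x = \int[mu]_x (f x * (normal_pdf m s x)%:E))%E.
Proof.
move=> mf f0; have dom := normal_prob_dominates m s.
rewrite -(Radon_Nikodym_SigmaFinite.change_of_variables dom)//.
have iRN := Radon_Nikodym_SigmaFinite.f_integrable dom.
apply: ae_eq_integral => //.
- by apply: emeasurable_funM => //; exact: (measurable_int _ iRN).
- apply: emeasurable_funM => //.
  by apply/measurable_EFinP; exact: measurable_normal_pdf.
- apply: ae_eqe_mul2l; apply: integral_ae_eq => //.
  + by apply/measurable_EFinP; exact: measurable_normal_pdf.
  + by move=> E _ mE; rewrite -Radon_Nikodym_SigmaFinite.f_integral.
Qed.

Lemma normal_pdf_affine (x v u : R) : 0 < v ->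
  normal_pdf x v (x + v * u) * v = normal_pdf 0 1 u.
Proof.
move=> v0; rewrite !normal_pdfE ?gt_eqF ?ltr01 ?lt0r_neq0//.
rewrite /normal_peak /normal_fun mulrAC; congr (_ * _); last first.
  congr expR; field; exact: lt0r_neq0.
rewrite expr1n mul1r -mulrnAr (sqrtrM (pi *+ 2)) ?sqr_ge0// sqrtr_sqr gtr0_norm//.
by rewrite invfM mulrAC mulVf ?mul1r// gt_eqF.
Qed.

(** The substitution y = x + v u.  Comparing two centers through the standard law
    also gives translation invariance, which is how it is used in [gauss_opE]. *)
Lemma integral_normal_affine (x v : R) (f : R -> R) : 0 < v ->
  continuous f -> (forall y, 0 <= f y) ->
  (\int[N x v]_y (f y)%:E = \int[N 0 1]_u (f (x + v * u)%R)%:E)%E.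
Proof.
move=> v0 cf f0.
have mf : measurable_fun [set: R] f by exact: continuous_measurable_fun.
pose F (u : R) := x + v * u.
have dF (u : R) : is_derive u 1 F v.
  rewrite /F; apply: is_derive_eq. by rewrite add0r mul1r /GRing.scale/= mulr1.
have F'E : F^`()%classic = cst v.
  by apply/funext => u; rewrite derive1E; case: (dF u).
have cF : continuous F.
  by move=> u; apply/differentiable_continuous/derivable1_diffP; case: (dF u).
have m1 : measurable_fun [set: R] (EFin \o f) by exact/measurable_EFinP.
have m2 : measurable_fun [set: R] (EFin \o (f \o F)).
  apply/measurable_EFinP; apply: continuous_measurable_fun => u.
  exact: (continuous_comp (cF u) (cf _)).
have p1 y : (0 <= (EFin \o f) y)%E by rewrite lee_fin.
have p2 y : (0 <= (EFin \o (f \o F)) y)%E by rewrite lee_fin; exact: f0.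
rewrite (ge0_integral_normal_prob x v m1 p1).
rewrite (ge0_integral_normal_prob 0 1 m2 p2).
under eq_integral do rewrite /= -EFinM.
rewrite (increasing_ge0_integration_by_substitutionT (F := F)
  (G := fun y => f y * normal_pdf x v y)).
- apply: eq_integral => u _; rewrite F'E /=; congr EFin.
  by rewrite -(normal_pdf_affine x u v0) mulrA.
- by move=> a b ab; rewrite /F ltrD2l ltr_pM2l.
- by rewrite F'E => ?; exact: cvg_cst.
- by rewrite F'E; exact: is_cvg_cst.
- by rewrite F'E; exact: is_cvg_cst.
- by move=> u; case: (dF u).
- apply/cvgrNyPle => A; near=> u.
  have : u <= (A - x) / v by near: u; apply: nbhs_ninfty_le; exact: num_real.
  by rewrite ler_pdivlMr// lerBrDl mulrC.
- apply/cvgryPge => A; near=> u.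
  have : (A - x) / v <= u by near: u; apply: nbhs_pinfty_ge; exact: num_real.
  by rewrite ler_pdivrMr// lerBlDl mulrC.
- move=> y; apply: continuousM; first exact: cf.
  by apply: continuous_normal_pdf; rewrite gt_eqF.
- by move=> y; rewrite mulr_ge0// normal_pdf_ge0.
Unshelve. all: by end_near. Qed.

Lemma normal_peakE (s : R) : 0 < s ->
  normal_peak s = (s * Num.sqrt (pi *+ 2))^-1.
Proof.
move=> s0; rewrite /normal_peak -mulrnAr sqrtrM ?sqr_ge0// sqrtr_sqr.
by rewrite gtr0_norm.
Qed.

(** Completing the square in [x]: this one identity carries the convolution of
    two Gaussian laws, since the second factor on the right integrates to 1. *)
Lemma normal_pdf_mul (m a b c x y : R) : 0 < a -> 0 < b -> 0 < c ->
  c ^+ 2 = a ^+ 2 + b ^+ 2 ->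
  normal_pdf m a x * normal_pdf x b y = normal_pdf m c y *
    normal_pdf ((m * b ^+ 2 + y * a ^+ 2) / c ^+ 2) (a * b / c) x.
Proof.
move=> a0 b0 c0 cE.
have s0 : 0 < a * b / c by rewrite divr_gt0 ?mulr_gt0.
rewrite !normal_pdfE ?gt_eqF// !normal_peakE// /normal_fun !(mulrACA _ (expR _)).
rewrite -!expRD; congr (_ * _).
  rewrite -!invfM; congr (_^-1); field; exact: lt0r_neq0.
congr expR.
have -> : (a * b / c) ^+ 2 = a ^+ 2 * b ^+ 2 / c ^+ 2.
  by rewrite expr_div_n exprMn.
rewrite cE; field.
by rewrite -cE expf_neq0 ?(lt0r_neq0 c0)//= !lt0r_neq0.
Qed.

Lemma measurable_normal_pdf2 (b : R) : b != 0 ->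
  measurable_fun [set: R * R] (fun z : R * R => normal_pdf z.1 b z.2).
Proof.
move=> b0; rewrite (_ : (fun z => _) =
    (fun z : R * R => normal_peak b * expR (- (z.2 - z.1) ^+ 2 / (b ^+ 2 *+ 2)))).
  apply: measurable_funM => //; apply: measurableT_comp => //.
  apply: measurable_funM => //; apply: measurableT_comp => //.
  by apply: measurable_funX; exact: measurable_funB.
by apply/funext => z; rewrite normal_pdfE.
Qed.

Lemma integral_normal_conv (m a b c : R) (f : R -> R) :
  0 < a -> 0 < b -> 0 < c -> c ^+ 2 = a ^+ 2 + b ^+ 2 ->
  measurable_fun [set: R] f -> (forall y, 0 <= f y) ->
  (\int[N m a]_x (\int[N x b]_y (f y)%:E) = \int[N m c]_y (f y)%:E)%E.
Proof.
move=> a0 b0 c0 cE mf f0.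
have m1 : measurable_fun [set: R] (EFin \o f) by exact/measurable_EFinP.
have p1 y : (0 <= (EFin \o f) y)%E by rewrite lee_fin; exact: f0.
have mfp : measurable_fun [set: R * R]
    (fun z : R * R => (f z.2 * normal_pdf z.1 b z.2)%:E).
  apply/measurable_EFinP; apply: measurable_funM.
    exact: (measurableT_comp mf).
  by apply: measurable_normal_pdf2; rewrite gt_eqF.
have p2 (z : R * R) : (0 <= (f z.2 * normal_pdf z.1 b z.2)%:E)%E.
  by rewrite lee_fin mulr_ge0// normal_pdf_ge0.
pose g x := (\int[mu]_y (f y * normal_pdf x b y)%:E)%E.
have mg : measurable_fun [set: R] g.
  exact: (measurable_fun_fubini_tonelli_F (m2 := mu) _ mfp p2).
have pg x : (0 <= g x)%E.
  by apply: integral_ge0 => y _; rewrite lee_fin mulr_ge0// normal_pdf_ge0.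
have -> : (fun x => (\int[N x b]_y (f y)%:E)%E) = g.
  apply/funext => x; rewrite (ge0_integral_normal_prob x b m1 p1).
  by apply: eq_integral => y _; rewrite /= -EFinM.
rewrite (ge0_integral_normal_prob m a mg pg).
pose h (z : R * R) := (f z.2 * normal_pdf z.1 b z.2 * normal_pdf m a z.1)%:E.
have mh : measurable_fun [set: R * R] h.
  apply/measurable_EFinP; apply: measurable_funM; first exact/measurable_EFinP.
  exact: (measurableT_comp (measurable_normal_pdf m a)).
have ph z : (0 <= h z)%E.
  by rewrite lee_fin !mulr_ge0// normal_pdf_ge0.
transitivity (\int[mu]_x \int[mu]_y h (x, y))%E.
  apply: eq_integral => x _; rewrite /g /h -ge0_integralZr//=.
  - apply/measurable_EFinP; apply: measurable_funM => //.
    exact: measurable_normal_pdf.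
  - by move=> y _; rewrite lee_fin mulr_ge0// normal_pdf_ge0.
  - by rewrite lee_fin normal_pdf_ge0.
rewrite (fubini_tonelli (m1 := mu) (m2 := mu) _ mh ph).
rewrite (ge0_integral_normal_prob m c m1 p1).
apply: eq_integral => y _; rewrite /h /=.
under eq_integral => x _ do rewrite -mulrA (mulrC (normal_pdf x b y))
  (normal_pdf_mul m x y a0 b0 c0 cE) mulrA EFinM.
rewrite ge0_integralZl//=.
- by rewrite integral_normal_pdf mule1.
- by apply/measurable_EFinP; exact: measurable_normal_pdf.
- by move=> x _; rewrite lee_fin normal_pdf_ge0.
- by rewrite lee_fin mulr_ge0// normal_pdf_ge0.
Qed.

(** Exponential tilting of a Gaussian is a translation of its mean. *)
Lemma normal_pdf_tilt (m s b x : R) : 0 < s ->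
  expR (b * x) * normal_pdf m s x =
  expR (m * b + s ^+ 2 * b ^+ 2 / 2) * normal_pdf (m + s ^+ 2 * b) s x.
Proof.
move=> s0; rewrite !normal_pdfE ?gt_eqF// /normal_fun.
rewrite mulrCA [RHS]mulrCA; congr (_ * _); rewrite -!expRD; congr expR.
by field; exact: lt0r_neq0.
Qed.

Lemma integral_normal_tilt (m s b : R) (f : R -> R) : 0 < s ->
  measurable_fun [set: R] f -> (forall y, 0 <= f y) ->
  (\int[N m s]_x (expR (b * x) * f x)%:E =
   (expR (m * b + s ^+ 2 * b ^+ 2 / 2))%:E *
   \int[N (m + s ^+ 2 * b)%R s]_x (f x)%:E)%E.
Proof.
move=> s0 mf f0.
have m1 : measurable_fun [set: R] (EFin \o f) by exact/measurable_EFinP.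
have p1 y : (0 <= (EFin \o f) y)%E by rewrite lee_fin; exact: f0.
have m2 : measurable_fun [set: R] (EFin \o (fun x => expR (b * x) * f x)).
  apply/measurable_EFinP; apply: measurable_funM => //.
  by apply: measurableT_comp => //; exact: measurable_funM.
have p2 y : (0 <= (EFin \o (fun x => expR (b * x) * f x)%R) y)%E.
  by rewrite lee_fin mulr_ge0// expR_ge0.
rewrite (ge0_integral_normal_prob m s m2 p2).
rewrite (ge0_integral_normal_prob _ s m1 p1).
rewrite -ge0_integralZl//=.
- apply: eq_integral => x _; rewrite -!EFinM; congr EFin.
  by rewrite mulrAC normal_pdf_tilt//; ring.
- apply: emeasurable_funM => //.
  by apply/measurable_EFinP; exact: measurable_normal_pdf.
- by move=> x _; rewrite -EFinM lee_fin mulr_ge0// normal_pdf_ge0.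
Qed.

Lemma measurable_expRM (b : R) : measurable_fun [set: R] (fun x => expR (b * x)).
Proof. by apply: measurableT_comp => //; exact: measurable_funM. Qed.

Lemma integral_normal_expR (m s b : R) : 0 < s ->
  (\int[N m s]_x (expR (b * x))%:E =
   (expR (m * b + s ^+ 2 * b ^+ 2 / 2))%:E)%E.
Proof.
move=> s0; have := @integral_normal_tilt m s b (cst 1) s0.
move=> /(_ (measurable_cst _) (fun=> ler01)).
under eq_integral do rewrite mulr1.
move=> ->; transitivity ((expR (m * b + s ^+ 2 * b ^+ 2 / 2))%:E *
  (\int[N (m + s ^+ 2 * b)%R s]_x cst 1%E x))%E => //.
rewrite integral_cst// mul1e [X in (_ * X)%E](_ : _ = 1%E) ?mule1//.
exact: (@probability_setT _ _ _ (N _ s)).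
Qed.

Lemma integrable_normal_expR (m s b : R) : 0 < s ->
  (N m s).-integrable setT (EFin \o (fun x => expR (b * x))).
Proof.
move=> s0; apply/integrableP; split.
  by apply/measurable_EFinP; exact: measurable_expRM.
under eq_integral do rewrite /= ger0_norm ?expR_ge0//.
by rewrite integral_normal_expR// ltry.
Qed.

Lemma expR_norm_le (c x : R) : expR (c * `|x|) <= expR (c * x) + expR (- c * x).
Proof.
case: (lerP 0 x) => x0; first by rewrite ger0_norm// lerDl expR_ge0.
by rewrite ltr0_norm// mulrN mulNr lerDr expR_ge0.
Qed.

(** All integrands met below have at most exponential growth, which is the only
    integrability criterion used for Gaussian laws. *)
Lemma integrable_normal_exp_bound (m s c K : R) (f : R -> R) : 0 < s ->
  measurable_fun [set: R] f -> (forall x, `|f x| <= K * expR (c * `|x|)) ->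
  (N m s).-integrable setT (EFin \o f).
Proof.
move=> s0 mf fK.
have K0 : 0 <= K.
  by have := le_trans (normr_ge0 _) (fK 0); rewrite pmulr_lge0 ?expR_gt0.
have I b := integrableZl measurableT K (integrable_normal_expR m b s0).
apply: (le_integrable _ _ _ (integrableD _ (I c) (I (- c)))) => //.
  exact/measurable_EFinP.
move=> x _; rewrite /= lee_fin.
rewrite [leRHS]ger0_norm; last by rewrite addr_ge0// mulr_ge0// expR_ge0.
by rewrite (le_trans (fK x))// -mulrDr ler_wpM2l// expR_norm_le.
Qed.

Lemma eq0_of_small (p C : R) :
  (forall b, 0 < b <= 1 -> `|p| <= b * C) -> p = 0.
Proof.
move=> h; apply/eqP; rewrite -normr_eq0 eq_le normr_ge0 andbT leNgt; apply/negP => p0.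
have C0 : 0 < C by have := h 1; rewrite ltr01 lexx mul1r => /(_ isT); lra.
pose b := Num.min 1 (`|p| / (2 * C)).
have b0 : 0 < b by rewrite lt_min ltr01 divr_gt0// mulr_gt0.
have b1 : b <= 1 by rewrite ge_min lexx.
have := h b; rewrite b0 b1 => /(_ isT).
apply/negP; rewrite -ltNge (@le_lt_trans _ _ (`|p| / (2 * C) * C))//.
  by rewrite ler_wpM2r ?(ltW C0)// ge_min lexx orbT.
have -> : `|p| / (2 * C) * C = `|p| / 2 by field; exact: lt0r_neq0.
by rewrite ltr_pdivrMr// ltr_pMr// ltr1n.
Qed.

Lemma integrable_normal_expR_center (m s a c K : R) (f : R -> R) : 0 < s ->
  0 <= c -> measurable_fun [set: R] f ->
  (forall x, `|f x| <= K * expR (c * `|x - a|)) ->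
  (N m s).-integrable setT (EFin \o f).
Proof.
move=> s0 c0 mf fK; have K0 : 0 <= K.
  by have := le_trans (normr_ge0 _) (fK 0); rewrite pmulr_lge0 ?expR_gt0.
apply: (@integrable_normal_exp_bound m s c (K * expR (c * `|a|))) => // x.
apply: (le_trans (fK x)); rewrite -mulrA ler_wpM2l// -expRD ler_expR -mulrDr.
by rewrite ler_wpM2l// [leRHS]addrC ler_normB.
Qed.

(** Absorbs powers into the exponential, through v <= e^v. *)
Lemma norm_expR_le (k : nat) (c v : R) : `|v| ^+ k * expR (c * `|v|) <=
  expR ((k%:R + c) * `|v|).
Proof.
rewrite mulrDl expRD ler_wpM2r ?expR_ge0// (mulrC k%:R) expRM_natr lerXn2r ?nnegrE//.
by have := expR_ge1Dx `|v|; lra.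
Qed.

(** The moments are read off the moment generating function: comparing
    e^{s^2 b^2 / 2} with 1 + b m1 + b^2 m2 / 2 up to O(b^3), as b tends to 0,
    identifies first m1 and then m2. *)
Lemma normal_mean_variance (m s : R) : 0 < s ->
  \int[N m s]_x (x - m) = 0 /\ \int[N m s]_x ((x - m) ^+ 2) = s ^+ 2.
Proof.
move=> s0.
have mv : measurable_fun [set: R] (fun x : R => x - m) by exact: measurable_funB.
have I1 : (N m s).-integrable setT (EFin \o (fun x => x - m)).
  apply: (@integrable_normal_expR_center m s m 1 1) => // x.
  rewrite mul1r; have := norm_expR_le 1 0 (x - m).
  by rewrite expr1 mul0r expR0 mulr1 addr0.
have I2 : (N m s).-integrable setT (EFin \o (fun x => (x - m) ^+ 2)).
  apply: (@integrable_normal_expR_center m s m 2 1) => //.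
    exact: measurable_funX.
  move=> x; rewrite mul1r; have := norm_expR_le 2 0 (x - m).
  by rewrite mul0r expR0 mulr1 addr0 normrX.
have I3 : (N m s).-integrable setT
    (EFin \o (fun x => `|x - m| ^+ 3 * expR `|x - m|)).
  apply: (@integrable_normal_expR_center m s m 4 1) => //.
    apply: measurable_funM; first by apply: measurable_funX; exact: measurableT_comp.
    by apply: measurableT_comp => //; exact: measurableT_comp.
  move=> x; rewrite ger0_norm ?mulr_ge0 ?expR_ge0 ?exprn_ge0//.
  have := norm_expR_le 3 1 (x - m).
  by rewrite !mul1r -(natrD _ 3 1).
pose m1 := \int[N m s]_x (x - m).
pose m2 := \int[N m s]_x ((x - m) ^+ 2).
pose C := \int[N m s]_x (`|x - m| ^+ 3 * expR `|x - m|).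
have key b : 0 < b <= 1 ->
    `|expR (s ^+ 2 * b ^+ 2 / 2) - 1 - b * m1 - (b ^+ 2 / 2) * m2| <= b ^+ 3 * C.
  move=> /andP[b0 b1].
  have Ie : (N m s).-integrable setT (EFin \o (fun x => expR (b * (x - m)))).
    have := integrableZl measurableT (expR (- (b * m))) (integrable_normal_expR m b s0).
    apply: eq_integrable => // x _; rewrite /= -EFinM -expRD; congr (expR _)%:E.
    by rewrite mulrBr addrC.
  have Ee : \int[N m s]_x expR (b * (x - m)) = expR (s ^+ 2 * b ^+ 2 / 2).
    transitivity (\int[N m s]_x (expR (- (b * m)) * expR (b * x))).
      by apply: eq_Rintegral => x _; rewrite -expRD; congr expR; ring.
    rewrite RintegralZl//; last exact: integrable_normal_expR.
    rewrite /Rintegral integral_normal_expR//= -expRD; congr expR; ring.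
  have Ic : (N m s).-integrable setT (EFin \o cst (1 : R)).
    by apply/finite_measure_integrable_cst.
  have Ib1 : (N m s).-integrable setT (EFin \o (fun x => b * (x - m))).
    by have := integrableZl measurableT b I1; apply: eq_integrable.
  have Ib2 : (N m s).-integrable setT (EFin \o (fun x => b ^+ 2 / 2 * (x - m) ^+ 2)).
    by have := integrableZl measurableT (b ^+ 2 / 2) I2; apply: eq_integrable.
  have J1 : (N m s).-integrable setT (EFin \o (fun x => expR (b * (x - m)) - 1)).
    by have := integrableB measurableT Ie Ic; apply: eq_integrable.
  have J2 : (N m s).-integrable setT
      (EFin \o (fun x => expR (b * (x - m)) - 1 - b * (x - m))).
    by have := integrableB measurableT J1 Ib1; apply: eq_integrable.
  have J3 : (N m s).-integrable setT
      (EFin \o (fun x => expR (b * (x - m)) - 1 - b * (x - m) -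
         b ^+ 2 / 2 * (x - m) ^+ 2)).
    by have := integrableB measurableT J2 Ib2; apply: eq_integrable.
  have <- : \int[N m s]_x (expR (b * (x - m)) - 1 - b * (x - m) -
      b ^+ 2 / 2 * (x - m) ^+ 2) =
      expR (s ^+ 2 * b ^+ 2 / 2) - 1 - b * m1 - b ^+ 2 / 2 * m2.
    rewrite RintegralB// RintegralB// RintegralB// Ee RintegralZl// RintegralZl//.
    by rewrite (Rintegral_prob_cst (N m s)).
  apply: (le_trans (le_normr_Rintegral measurableT J3)).
  rewrite -RintegralZl//; apply: le_Rintegral => //.
  - by have := integrable_norm J3; apply: eq_integrable.
  - by have := integrableZl measurableT (b ^+ 3) I3; apply: eq_integrable.
  - move=> x _.
    have -> : b ^+ 2 / 2 * (x - m) ^+ 2 = (b * (x - m)) ^+ 2 / 2 by field.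
    apply: (le_trans (expR_taylor3 _)).
    rewrite normrM (gtr0_norm b0) exprMn -mulrA ler_wpM2l ?exprn_ge0 ?(ltW b0)//.
    rewrite ler_wpM2l ?exprn_ge0// ler_expR.
    by rewrite ler_piMl.
pose D := s ^+ 4 * expR (s ^+ 2).
have key2 b : 0 < b <= 1 ->
    `|b * m1 + b ^+ 2 * ((m2 - s ^+ 2) / 2)| <= b ^+ 3 * (C + D).
  move=> b01; have := key b b01; move: b01 => /andP[b0 b1].
  pose q := s ^+ 2 * b ^+ 2 / 2.
  have q0 : 0 <= q by rewrite /q divr_ge0// mulr_ge0// sqr_ge0.
  have := expR_taylor2 q.
  rewrite -/q (ger0_norm q0) => h1 h2.
  have h3 : q ^+ 2 * expR q <= b ^+ 3 * D.
    have -> : b ^+ 3 * D = (s ^+ 4 * b ^+ 3) * expR (s ^+ 2) by rewrite /D; ring.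
    have b21 : b ^+ 2 <= 1 by rewrite expr_le1// ltW.
    rewrite ler_pM ?expR_ge0 ?exprn_ge0//.
      have -> : q ^+ 2 = (s ^+ 4 * b ^+ 3) * (b / 4) by rewrite /q; field.
      rewrite ler_piMr ?mulr_ge0 ?exprn_ge0 ?(ltW s0) ?(ltW b0)//; lra.
    rewrite ler_expR /q; have := sqr_ge0 s; nra.
  rewrite ler_norml; move: h1 h2; rewrite !ler_norml => /andP[h11 h12] /andP[h21 h22].
  have qE : q = b ^+ 2 * (s ^+ 2 / 2) by rewrite /q; ring.
  rewrite qE in h11 h12 h21 h22 h3.
  by apply/andP; split; lra.
have E1 : m1 = 0.
  apply: (@eq0_of_small _ (C + D + `|(m2 - s ^+ 2) / 2|)) => b b01.
  have := key2 b b01; move: b01 => /andP[b0 b1].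
  set Q := (m2 - s ^+ 2) / 2 => h.
  have h4 : `|b * m1| <= b ^+ 3 * (C + D) + b ^+ 2 * `|Q|.
    have -> : b * m1 = (b * m1 + b ^+ 2 * Q) - b ^+ 2 * Q by ring.
    rewrite (le_trans (ler_normB _ _))// lerD// normrM ger0_norm//.
    by rewrite exprn_ge0// ltW.
  have CD : 0 <= C + D.
    rewrite addr_ge0//; first by apply: Rintegral_ge0 => x _;
      rewrite mulr_ge0 ?expR_ge0 ?exprn_ge0.
    by rewrite /D mulr_ge0 ?expR_ge0// exprn_ge0// ltW.
  rewrite normrM gtr0_norm// in h4.
  rewrite -(ler_pM2l b0); apply: (le_trans h4).
  have -> : b * (b * (C + D + `|Q|)) = b ^+ 2 * (C + D) + b ^+ 2 * `|Q| by ring.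
  rewrite lerD2r ler_wpM2r// exprS ler_piMl// ?sqr_ge0//.
split => //.
have E2 : (m2 - s ^+ 2) / 2 = 0.
  apply: (@eq0_of_small _ (C + D)) => b b01.
  have := key2 b b01; move: b01 => /andP[b0 b1].
  have b20 : 0 < b ^+ 2 by rewrite exprn_gt0.
  rewrite E1 mulr0 add0r normrM (gtr0_norm b20).
  have -> : b ^+ 3 * (C + D) = b ^+ 2 * (b * (C + D)) by ring.
  by rewrite ler_pM2l.
rewrite -/m2; lra.
Qed.

End normal.

Section normal_tilted_moments.
Context {R : realType}.
Local Notation N := (@normal_prob R).

Lemma normal_second_moment (m s a : R) : 0 < s ->
  \int[N m s]_x ((x - a) ^+ 2) = (m - a) ^+ 2 + s ^+ 2.
Proof.
move=> s0; have [E1 E2] := normal_mean_variance m s0.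
have I1 : (N m s).-integrable setT (EFin \o (fun x => x - m)).
  apply: (@integrable_normal_expR_center _ m s m 1 1) => // [|x].
    exact: measurable_funB.
  rewrite mul1r; have := norm_expR_le 1 0 (x - m).
  by rewrite expr1 mul0r expR0 mulr1 addr0.
have I2 : (N m s).-integrable setT (EFin \o (fun x => (x - m) ^+ 2)).
  apply: (@integrable_normal_expR_center _ m s m 2 1) => // [|x].
    by apply: measurable_funX; exact: measurable_funB.
  rewrite mul1r; have := norm_expR_le 2 0 (x - m).
  by rewrite mul0r expR0 mulr1 addr0 normrX.
have Ic : (N m s).-integrable setT (EFin \o cst ((m - a) ^+ 2)).
  exact: finite_measure_integrable_cst.
have J1 : (N m s).-integrable setT (EFin \o (fun x => 2 * (m - a) * (x - m))).
  by have := integrableZl measurableT (2 * (m - a)) I1; apply: eq_integrable.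
have J2 : (N m s).-integrable setT
    (EFin \o (fun x => (x - m) ^+ 2 + 2 * (m - a) * (x - m))).
  by have := integrableD measurableT I2 J1; apply: eq_integrable.
transitivity (\int[N m s]_x ((x - m) ^+ 2 + 2 * (m - a) * (x - m) + (m - a) ^+ 2)).
  by apply: eq_Rintegral => x _; ring.
rewrite RintegralD// RintegralD// RintegralZl// E1 E2.
by rewrite (Rintegral_prob_cst (N m s)) mulr0 addr0 addrC.
Qed.

Lemma normal_tilted_second_moment (m s b a : R) : 0 < s ->
  \int[N m s]_x (expR (b * x) * (x - a) ^+ 2) =
  expR (m * b + s ^+ 2 * b ^+ 2 / 2) * ((m + s ^+ 2 * b - a) ^+ 2 + s ^+ 2).
Proof.
move=> s0; rewrite -normal_second_moment//.
rewrite /Rintegral (@integral_normal_tilt _ m s b (fun x => (x - a) ^+ 2)) => //.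
- rewrite fineM//.
  apply: integrable_fin_num => //.
  apply: (@integrable_normal_expR_center _ _ s a 2 1) => // [|x].
    by apply: measurable_funX; exact: measurable_funB.
  rewrite mul1r; have := norm_expR_le 2 0 (x - a).
  by rewrite mul0r expR0 mulr1 addr0 normrX.
- by apply: measurable_funX; exact: measurable_funB.
- by move=> y; exact: sqr_ge0.
Qed.

Lemma integrable_tilted_square (m s b a : R) : 0 < s ->
  (N m s).-integrable setT (EFin \o (fun x => expR (b * x) * (x - a) ^+ 2)).
Proof.
move=> s0.
apply: (@integrable_normal_expR_center _ m s a (2 + `|b|) (expR (b * a))) => //.
- apply: measurable_funM; first exact: measurable_expRM.
  by apply: measurable_funX; exact: measurable_funB.
move=> x; rewrite normrM normrX ger0_norm ?expR_ge0//.
have -> : b * x = b * a + b * (x - a) by ring.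
rewrite expRD -mulrA ler_wpM2l ?expR_ge0// mulrC.
apply: le_trans (norm_expR_le 2 `|b| (x - a)).
by rewrite ler_wpM2l ?exprn_ge0// ler_expR -normrM ler_norm.
Qed.

(** The identity 2 u = (u + 1)^2 - u^2 - 1 reduces a signed integrand to squares, to
    which the tilting formula for nonnegative functions applies. *)
Lemma normal_tilted_mean (m s b : R) : 0 < s ->
  tilted_mean (N m s) b = m + s ^+ 2 * b.
Proof.
move=> s0; rewrite /tilted_mean.
have E0 : \int[N m s]_x expR (b * x) = expR (m * b + s ^+ 2 * b ^+ 2 / 2).
  by rewrite /Rintegral integral_normal_expR.
have I1 := integrable_tilted_square m b (-1) s0.
have I0 := integrable_tilted_square m b 0 s0.
have Ie := integrable_normal_expR m b s0.
have J : (N m s).-integrable setT (EFin \o (fun x =>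
   expR (b * x) * (x - -1) ^+ 2 - expR (b * x) * (x - 0) ^+ 2)).
  by have := integrableB measurableT I1 I0; apply: eq_integrable.
have J2 : (N m s).-integrable setT (EFin \o (fun x =>
   expR (b * x) * (x - -1) ^+ 2 - expR (b * x) * (x - 0) ^+ 2 - expR (b * x))).
  by have := integrableB measurableT J Ie; apply: eq_integrable.
have -> : \int[N m s]_x (expR (b * x) * x) = \int[N m s]_x (2^-1 *
   (expR (b * x) * (x - -1) ^+ 2 - expR (b * x) * (x - 0) ^+ 2 - expR (b * x))).
  by apply: eq_Rintegral => x _; field.
rewrite RintegralZl// RintegralB// RintegralB// !normal_tilted_second_moment// E0.
field; exact: lt0r_neq0 (expR_gt0 _).
Qed.

Lemma normal_asymptotic_variance (m s b a : R) : 0 < s -> m + s ^+ 2 * b = a ->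
  asymptotic_variance (N m s) b a =
  expR ((a - m) ^+ 2 / s ^+ 2) * (((a - m) ^+ 2 + s ^+ 2) / s ^+ 4).
Proof.
move=> s0 ba; rewrite /asymptotic_variance !normal_tilted_second_moment// ba.
have s_neq0 := lt0r_neq0 s0.
set A := m * (2 * b) + _; set B := m * b + _.
have -> : A = B + B + (a - m) ^+ 2 / s ^+ 2 by rewrite /A /B -ba; field.
rewrite !expRD -ba; field.
  by rewrite subrr expr0n/= add0r s_neq0 expf_neq0//= !lt0r_neq0 ?expR_gt0.
Qed.

End normal_tilted_moments.

(** * Independence and partial sums of i.i.d. variables *)

Section independence.
Context {d : measure_display} {T : measurableType d} {R : realType}.
Context {d1 d2 : measure_display} {T1 : measurableType d1} {T2 : measurableType d2}.
Variable P : probability T R.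
Local Open Scope ereal_scope.

(** An instance of the uniqueness of measures: both sides are finite measures in [E]
    that agree on rectangles. *)
Lemma probability_pair_indep (Y : T -> T1) (Z : T -> T2) (C : set T) :
  measurable_fun [set: T] Y -> measurable_fun [set: T] Z -> measurable C ->
  (forall A B, measurable A -> measurable B ->
    P ((Y @^-1` A `&` Z @^-1` B) `&` C) = P (Y @^-1` A `&` Z @^-1` B) * P C) ->
  forall E : set (T1 * T2), measurable E ->
    P ((fun w => (Y w, Z w)) @^-1` E `&` C) =
    P ((fun w => (Y w, Z w)) @^-1` E) * P C.
Proof.
move=> mY mZ mC H E mE.
have mX : measurable_fun [set: T] (fun w => (Y w, Z w)) by exact: measurable_fun_pair.
pose X : {mfun T >-> (T1 * T2)%type} := mfun_Sub (mem_set mX).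
have PC0 : (0 <= fine (P C))%R by exact: fine_ge0.
pose m1 := pushforward (mrestr P mC) X.
pose m2 := mscale (NngNum PC0) (distribution P X).
have PCE : (fine (P C))%:E = P C by rewrite fineK// fin_num_measure.
have -> : P ((fun w => (Y w, Z w)) @^-1` E `&` C) = m1 E by [].
have -> : P ((fun w => (Y w, Z w)) @^-1` E) * P C = m2 E.
  by rewrite /m2 /mscale/= PCE muleC.
have m1_measure : measurable_fun [set: T] X by [].
pose G := [set A1 `*` A2 | A1 in @measurable _ T1 & A2 in @measurable _ T2].
apply: (measure_unique G (fun=> setT)) => //.
- exact: measurable_prod_measurableType.
- move=> _ _ [A1 mA1 [A2 mA2 <-]] [B1 mB1 [B2 mB2 <-]].
  exists (A1 `&` B1); first exact: measurableI.
  by exists (A2 `&` B2); [exact: measurableI|rewrite setXI].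
- by move=> _; exists setT => //; exists setT => //; rewrite setXTT.
- by rewrite bigcup_const.
- move=> _ [A mA [B mB <-]]; 
  rewrite -[LHS]/(P ((Y @^-1` A `&` Z @^-1` B) `&` C)) H// -[in LHS]PCE muleC.
  by [].
- move=> _; rewrite -[ltLHS]/(P (X @^-1` setT `&` C)) preimage_setT setTI.
  by rewrite (le_lt_trans (probability_le1 P mC)) ?ltry.
Qed.

Lemma integral_indep_pair (Y : T -> T1) (Z : T -> T2) (Q : probability T2 R) :
  measurable_fun [set: T] Y -> measurable_fun [set: T] Z ->
  (forall A B, measurable A -> measurable B ->
    P (Y @^-1` A `&` Z @^-1` B) = P (Y @^-1` A) * Q B) ->
  forall f : T1 * T2 -> \bar R, measurable_fun [set: T1 * T2] f ->
    (forall z, 0 <= f z) ->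
  \int[P]_w f (Y w, Z w) = \int[P]_w (\int[Q]_u f (Y w, u)).
Proof.
move=> mY mZ H f mf f0.
have mX : measurable_fun [set: T] (fun w => (Y w, Z w)) by exact: measurable_fun_pair.
pose X : {RV P >-> (T1 * T2)%type} := mfun_Sub (mem_set mX).
pose Y' : {RV P >-> T1} := mfun_Sub (mem_set mY).
transitivity (\int[distribution P X]_z f z).
  by rewrite ge0_integral_distribution.
transitivity (\int[distribution P Y' \x Q]_z f z).
  apply: eq_measure_integral => E mE _.
  by symmetry; apply: product_measure_unique => // A B mA mB; exact: H.
rewrite (fubini_tonelli1 (m1 := distribution P Y') (m2 := Q) f mf f0).
rewrite ge0_integral_distribution//.
- exact: (measurable_fun_fubini_tonelli_F (m2 := Q)).
- by move=> y; apply: integral_ge0.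
Qed.

End independence.

Lemma integrable_bounded (d : measure_display) (T : measurableType d)
    (R : realType) (P : probability T R) (f : T -> R) (M : R) :
  measurable_fun [set: T] f -> (forall x, `|f x| <= M) ->
  P.-integrable setT (EFin \o f).
Proof.
move=> mf fM.
have Ic : P.-integrable setT (EFin \o cst M) by exact: finite_measure_integrable_cst.
apply: (le_integrable _ _ _ Ic) => //.
  exact/measurable_EFinP.
by move=> x _; rewrite /= lee_fin (le_trans (fM x))// ler_norm.
Qed.

Lemma second_moment_tail (d : measure_display) (T : measurableType d)
    (R : realType) (P : probability T R) (X : T -> R) (V a : R) :
  measurable_fun [set: T] X -> (\int[P]_w (X w ^+ 2)%:E = V%:E)%E -> 0 < a ->
  (P [set w | (a <= `|X w|)%R] <= (V / a ^+ 2)%:E)%E.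
Proof.
move=> mX EV a0; pose X' : {RV P >-> R} := mfun_Sub (mem_set mX).
have a20 : 0 < a ^+ 2 by rewrite exprn_gt0.
have := @markov _ _ _ P X' (fun r => r ^+ 2) a a0.
have -> : [set w | (a%:E <= `|(X' w)%:E|)%E] = [set w | a <= `|X w|].
  by apply/seteqP; split => w /=; rewrite lee_fin.
move=> /(_ _ _ _) h.
have {}h : ((a ^+ 2)%:E * P [set w | (a <= `|X w|)%R] <=
    'E_P[(fun r => r ^+ 2)%R \o (fun r => `|r|)%R \o X'])%E.
  apply: h => //.
  - by move=> r _; exact: sqr_ge0.
  - by move=> u v u0 v0 uv; rewrite lerXn2r.
move: h; rewrite unlock.
under eq_integral do rewrite /= real_normK ?num_real//.
by rewrite EV => h; rewrite EFinM muleC lee_pdivlMl.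
Qed.

Definition partial_sum (R : realType) (T : Type) (phi : R -> R)
    (x : nat -> T -> R) (k : nat) (w : T) : R := \sum_(i < k) phi (x i w).

Section iid.
Context {d : measure_display} {T : measurableType d} {R : realType}.
Variables (P : probability T R) (x : nat -> {RV P >-> R}).
Variable F0 : probability (measurableTypeR R) R.
Hypothesis iid : iid_from x F0.
Variable phi : R -> R.
Hypothesis mphi : measurable_fun [set: R] phi.

Local Notation S := (partial_sum phi x).
Local Notation cyl s B := (\bigcap_(i in [set` s]) (x i @^-1` B i)).

Lemma measurable_partial_sum k : measurable_fun [set: T] (S k).
Proof. by apply: measurable_sum => i; exact: measurableT_comp. Qed.

Local Lemma measurable_cyl (s : seq nat) (B : nat -> set R) :
  (forall i, measurable (B i)) -> measurable (cyl s B).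
Proof.
move=> mB; apply: bigcap_measurableType => i _.
exact: measurable_funPTI.
Qed.

(** Carrying arbitrary later coordinates along is what makes the induction on [k]
    go through: the step merges coordinate [k] into the sum, using the induction
    hypothesis for the events indexed by [k :: s]. *)
Lemma partial_sum_indep k : forall A s B, measurable A -> uniq s ->
  (forall i, i \in s -> (k <= i)%N) -> (forall i, measurable (B i)) ->
  (P (S k @^-1` A `&` cyl s B) = P (S k @^-1` A) * P (cyl s B))%E.
Proof.
have [mind _] := iid.
elim: k => [|k IHk] A s B mA us sk mB.
  have -> : S 0 = cst 0 by apply/funext => w; rewrite /partial_sum big_ord0.
  rewrite preimage_cst; case: ifP => _.
    by rewrite setTI probability_setT mul1e.
  by rewrite set0I measure0 mul0e.
have ks : k \notin s by apply/negP => /sk; rewrite ltnn.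
pose B' (D : set R) i := if i == k then D else B i.
have mB' D i : measurable D -> measurable (B' D i) by rewrite /B'; case: eqP.
have cylcons D : x k @^-1` D `&` cyl s B = cyl (k :: s) (B' D).
  apply/seteqP; split => [w [Dw Cw] i|w Cw].
    rewrite /= inE /B' => /orP[/eqP ->|si]; first by rewrite eqxx.
    have /negbTE -> : i != k by apply: contraNneq ks => <-.
    exact: Cw.
  split; first by have := Cw k; rewrite /B' eqxx; apply; rewrite /= inE eqxx.
  move=> i /= si; have := Cw i; rewrite /B'.
  have /negbTE -> : i != k by apply: contraNneq ks => <-.
  by apply; rewrite /= inE si orbT.
have cyl1 D : x k @^-1` D = cyl [:: k] (B' D).
  apply/seteqP; split => [w Dw i|w Cw].
    by rewrite /= inE => /eqP ->; rewrite /B' eqxx.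
  by have := Cw k; rewrite /B' eqxx; apply; rewrite /= inE.
have step1 A0 D : measurable A0 -> measurable D ->
    (P (S k @^-1` A0 `&` x k @^-1` D) = P (S k @^-1` A0) * P (x k @^-1` D))%E.
  move=> mA0 mD; rewrite cyl1 IHk// => [i|i]; last exact: mB'.
  by rewrite inE => /eqP ->.
have step2 A0 D : measurable A0 -> measurable D ->
    (P ((S k @^-1` A0 `&` x k @^-1` D) `&` cyl s B) =
     P (S k @^-1` A0 `&` x k @^-1` D) * P (cyl s B))%E.
  move=> mA0 mD; rewrite -setIA step1// cylcons IHk//; last 3 first.
  - by rewrite /= ks.
  - by move=> i; rewrite inE => /orP[/eqP ->//|/sk/ltnW].
  - by move=> i; exact: mB'.
  rewrite -muleA; congr (_ * _)%E.
  rewrite mind; [|by rewrite /= ks|by move=> i; exact: mB'].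
  rewrite big_cons mind// {1}/B' eqxx; congr (_ * _)%E.
  apply: eq_big_seq => i si; rewrite /B'.
  by have /negbTE -> : i != k by apply: contraNneq ks => <-.
pose E := [set z : R * R | A (z.1 + phi z.2)].
have mE : measurable E.
  rewrite -[E]setTI; have mg : measurable_fun setT (fun z : R * R => z.1 + phi z.2).
    by apply: measurable_funD => //; exact: measurableT_comp.
  exact: mg.
have SE : S k.+1 @^-1` A = (fun w => (S k w, x k w)) @^-1` E.
  by apply/seteqP; split => w; rewrite /E /= /partial_sum big_ord_recr.
rewrite SE; apply: probability_pair_indep => //.
- exact: measurable_partial_sum.
- exact: measurable_cyl.
Qed.

(** The joint law of the partial sum and the next variable is a product, so the next
    variable can be integrated out first. *)
Lemma integral_partial_sum_next k (f : R * R -> \bar R) :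
  measurable_fun [set: R * R] f -> (forall z, 0 <= f z)%E ->
  (\int[P]_w f (S k w, x k w) = \int[P]_w (\int[F0]_u f (S k w, u)))%E.
Proof.
move=> mf f0; apply: (integral_indep_pair (T1 := R) (T2 := measurableTypeR R)) => //.
- exact: measurable_partial_sum.
- exact: (measurable_funPT (x k)).
move=> A B mA mB; have [_ idl] := iid; rewrite -(idl k B mB).
have -> : x k @^-1` B = cyl [:: k] (fun=> B).
  apply/seteqP; split => [w Dw i|w Cw].
    by rewrite /= inE => /eqP ->.
  by apply: Cw; rewrite /= inE.
rewrite partial_sum_indep//; last by move=> i; rewrite inE => /eqP ->.
congr (_ * P _)%E; apply/seteqP; split => [w Cw|w Dw i].
  by apply: Cw; rewrite /= inE.
by rewrite /= inE => /eqP ->.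
Qed.

Lemma integral_partial_sum_sqr (V : R) k :
  F0.-integrable setT (EFin \o phi) ->
  F0.-integrable setT (EFin \o (fun u => phi u ^+ 2)) ->
  \int[F0]_u phi u = 0 -> \int[F0]_u (phi u ^+ 2) = V ->
  (\int[P]_w (S k w ^+ 2)%:E = (k%:R * V)%:E)%E.
Proof.
move=> I1 I2 E1 E2.
have V0 : 0 <= V by rewrite -E2; apply: Rintegral_ge0 => u _; exact: sqr_ge0.
elim: k => [|k IHk].
  rewrite mul0r -[RHS](integral0 P setT); apply: eq_integral => w _.
  by rewrite /partial_sum big_ord0 expr0n.
pose f (z : R * R) := ((z.1 + phi z.2) ^+ 2)%:E.
have mf : measurable_fun [set: R * R] f.
  apply/measurable_EFinP; apply: measurable_funX; apply: measurable_funD => //.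
  exact: measurableT_comp.
have f0 z : (0 <= f z)%E by rewrite lee_fin sqr_ge0.
transitivity (\int[P]_w f (S k w, x k w))%E.
  by apply: eq_integral => w _; rewrite /f /partial_sum big_ord_recr.
rewrite (integral_partial_sum_next k mf f0).
have inner s : (\int[F0]_u f (s, u) = (s ^+ 2)%:E + V%:E)%E.
  have J1 : F0.-integrable setT (EFin \o (fun u => 2 * s * phi u)).
    by have := integrableZl measurableT (2 * s) I1; apply: eq_integrable.
  have Jc : F0.-integrable setT (EFin \o cst (s ^+ 2)).
    exact: finite_measure_integrable_cst.
  have J2 : F0.-integrable setT (EFin \o (fun u => phi u ^+ 2 + 2 * s * phi u)).
    by have := integrableD measurableT I2 J1; apply: eq_integrable.
  have J3 : F0.-integrable setT
      (EFin \o (fun u => phi u ^+ 2 + 2 * s * phi u + s ^+ 2)).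
    by have := integrableD measurableT J2 Jc; apply: eq_integrable.
  transitivity (\int[F0]_u (phi u ^+ 2 + 2 * s * phi u + s ^+ 2)%:E)%E.
    by apply: eq_integral => u _; rewrite /f /=; congr EFin; ring.
  rewrite -[LHS]fineK; last exact: integrable_fin_num J3.
  rewrite -EFinD; congr EFin.
  rewrite -[LHS]/(\int[F0]_u (phi u ^+ 2 + 2 * s * phi u + s ^+ 2)).
  rewrite RintegralD// RintegralD// RintegralZl// E1 E2 mulr0 addr0 addrC.
  by rewrite Rintegral_prob_cst.
under eq_integral do rewrite inner.
rewrite ge0_integralD//.
- rewrite IHk integral_cst//= probability_setT mule1 -EFinD; congr EFin.
  by rewrite -natr1 mulrDl mul1r.
- by move=> w _; rewrite lee_fin sqr_ge0.
- by apply/measurable_EFinP; apply: measurable_funX; exact: measurable_partial_sum.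
Qed.

Lemma partial_sum_chebyshev (V a : R) k :
  F0.-integrable setT (EFin \o phi) ->
  F0.-integrable setT (EFin \o (fun u => phi u ^+ 2)) ->
  \int[F0]_u phi u = 0 -> \int[F0]_u (phi u ^+ 2) = V -> 0 < a ->
  (P [set w | (a <= `|S k w|)%R] <= (k%:R * V / a ^+ 2)%:E)%E.
Proof.
move=> I1 I2 E1 E2 a0; apply: second_moment_tail => //.
  exact: measurable_partial_sum.
exact: integral_partial_sum_sqr.
Qed.

(** One step of the exchange argument, in a one-sided form; adding the bound [M]
    makes the integrands nonnegative, hence amenable to Tonelli's theorem. *)
Lemma partial_sum_step_le k (f g : R -> R) (M : R) :
  measurable_fun [set: R] f -> measurable_fun [set: R] g ->
  (forall y, `|f y| <= M) -> (forall y, `|g y| <= M) ->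
  (forall s, \int[F0]_u f (s + phi u) <= g s) ->
  \int[P]_w f (S k.+1 w) <= \int[P]_w g (S k w).
Proof.
move=> mf mg fM gM fg.
have mS := measurable_partial_sum.
have If : P.-integrable setT (EFin \o (fun w => f (S k.+1 w))).
  by apply: (@integrable_bounded _ _ _ _ _ M) => //; exact: measurableT_comp.
have Ig : P.-integrable setT (EFin \o (fun w => g (S k w))).
  by apply: (@integrable_bounded _ _ _ _ _ M) => //; exact: measurableT_comp.
have Ic : P.-integrable setT (EFin \o cst M).
  exact: finite_measure_integrable_cst.
pose h (z : R * R) := (f (z.1 + phi z.2) + M)%:E.
have mh : measurable_fun [set: R * R] h.
  apply/measurable_EFinP; apply: measurable_funD => //; apply: measurableT_comp => //.
  by apply: measurable_funD => //; exact: measurableT_comp.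
have fM0 y : 0 <= f y + M by have := fM y; rewrite ler_norml; lra.
have gM0 y : 0 <= g y + M by have := gM y; rewrite ler_norml; lra.
have h0 z : (0 <= h z)%E by rewrite lee_fin fM0.
have inner s : (\int[F0]_u h (s, u) <= (g s + M)%:E)%E.
  have Jf : F0.-integrable setT (EFin \o (fun u => f (s + phi u))).
    apply: (@integrable_bounded _ _ _ _ _ M) => //.
    by apply: measurableT_comp => //; exact: measurable_funD.
  have Jc : F0.-integrable setT (EFin \o cst M).
    exact: finite_measure_integrable_cst.
  have J : F0.-integrable setT (EFin \o (fun u => f (s + phi u) + M)).
    by have := integrableD measurableT Jf Jc; apply: eq_integrable.
  rewrite -[leLHS]fineK; last exact: integrable_fin_num J.
  rewrite lee_fin -[leLHS]/(\int[F0]_u (f (s + phi u) + M)) RintegralD//.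
  by rewrite Rintegral_prob_cst lerD2r.
rewrite -(lerD2r M) -[in leLHS](Rintegral_prob_cst P M).
rewrite -[in leRHS](Rintegral_prob_cst P M) -!RintegralD// /Rintegral.
have Jf : P.-integrable setT (EFin \o (fun w => f (S k.+1 w) + M)).
  by have := integrableD measurableT If Ic; apply: eq_integrable.
have Jg : P.-integrable setT (EFin \o (fun w => g (S k w) + M)).
  by have := integrableD measurableT Ig Ic; apply: eq_integrable.
rewrite fine_le//; [exact: integrable_fin_num Jf|exact: integrable_fin_num Jg|].
apply: (@le_trans _ _ (\int[P]_w h (S k w, x k w))%E).
  rewrite le_eqVlt; apply/orP; left; apply/eqP; apply: eq_integral => w _.
  by rewrite /h /= /partial_sum big_ord_recr.
rewrite (integral_partial_sum_next k mh h0).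
apply: ge0_le_integral => //.
- by move=> w _; apply: integral_ge0.
- have := measurable_fun_fubini_tonelli_F (m2 := F0) h mh h0.
  by move=> mF; exact: (measurableT_comp mF (mS k)).
- by apply/measurable_EFinP; apply: measurable_funD => //; exact: measurableT_comp.
Qed.

End iid.

(** * Lindeberg's central limit theorem for smooth test functions *)

Lemma bounded_lipschitz_continuous (R : realType) (K : R) (f : R -> R) :
  bounded_lipschitz K f -> continuous f.
Proof.
move=> [bf lf] x; apply/cvgrPdist_le => e e0.
have K0 : 0 <= K := le_trans (normr_ge0 _) (bf 0).
have K1 : 0 < K + 1 by rewrite ltr_wpDl.
have eK : 0 < e / (K + 1) by rewrite divr_gt0.
near=> y; apply: (le_trans (lf y x)).
apply: (@le_trans _ _ ((K + 1) * (e / (K + 1)))); last first.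
  by rewrite mulrCA divff ?mulr1// gt_eqF.
apply: ler_pM => //; first by rewrite lerDl. 
Unshelve. all: by end_near. Qed.

Lemma bounded_lipschitz_measurable (R : realType) (K : R) (f : R -> R) :
  bounded_lipschitz K f -> measurable_fun [set: R] f.
Proof. by move/bounded_lipschitz_continuous; exact: continuous_measurable_fun. Qed.

Lemma normr_Rintegral_le (d : measure_display) (T : measurableType d)
    (R : realType) (P : probability T R) (f : T -> R) (M : R) :
  measurable_fun [set: T] f -> (forall x, `|f x| <= M) ->
  `|\int[P]_x f x| <= M.
Proof.
move=> mf fM; have If := integrable_bounded P mf fM.
rewrite (le_trans (le_normr_Rintegral measurableT If))//.
rewrite -[leRHS](Rintegral_prob_cst P); apply: le_Rintegral => //.
- by have := integrable_norm If; apply: eq_integrable.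
- exact: finite_measure_integrable_cst.
Qed.

(** A centered law enters the average of a smooth function only through its
    variance, up to its third absolute moment.  Used once for the summands and once
    for the Gaussian law of the same variance. *)
Lemma Rintegral_taylor (d : measure_display) (T : measurableType d)
    (R : realType) (Q : probability T R) (phi : T -> R) (K V : R)
    (f f1 f2 : R -> R) (s : R) :
  measurable_fun [set: T] phi ->
  Q.-integrable setT (EFin \o phi) ->
  Q.-integrable setT (EFin \o (fun u => phi u ^+ 2)) ->
  Q.-integrable setT (EFin \o (fun u => `|phi u| ^+ 3)) ->
  \int[Q]_u phi u = 0 -> \int[Q]_u (phi u ^+ 2) = V ->
  smooth3 K f f1 f2 ->
  `|\int[Q]_u f (s + phi u) - f s - f2 s / 2 * V| <=
  K * \int[Q]_u `|phi u| ^+ 3.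
Proof.
move=> mphi I1 I2 I3 E1 E2 [bf b1 b2 Tf].
have If : Q.-integrable setT (EFin \o (fun u => f (s + phi u))).
  apply: (@integrable_bounded _ _ _ _ _ K) => [|u]; last exact: bf.1.
  apply: (measurableT_comp (bounded_lipschitz_measurable bf)); exact: measurable_funD.
have Ic : Q.-integrable setT (EFin \o cst (f s)).
  exact: finite_measure_integrable_cst.
have J0 : Q.-integrable setT (EFin \o (fun u => f (s + phi u) - f s)).
  by have := integrableB measurableT If Ic; apply: eq_integrable.
have K1 : Q.-integrable setT (EFin \o (fun u => f1 s * phi u)).
  by have := integrableZl measurableT (f1 s) I1; apply: eq_integrable.
have J1 : Q.-integrable setT (EFin \o (fun u => f (s + phi u) - f s - f1 s * phi u)).
  by have := integrableB measurableT J0 K1; apply: eq_integrable.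
have K2 : Q.-integrable setT (EFin \o (fun u => f2 s / 2 * phi u ^+ 2)).
  by have := integrableZl measurableT (f2 s / 2) I2; apply: eq_integrable.
have J2 : Q.-integrable setT (EFin \o (fun u =>
    f (s + phi u) - f s - f1 s * phi u - f2 s / 2 * phi u ^+ 2)).
  by have := integrableB measurableT J1 K2; apply: eq_integrable.
have <- : \int[Q]_u (f (s + phi u) - f s - f1 s * phi u - f2 s / 2 * phi u ^+ 2) =
    \int[Q]_u f (s + phi u) - f s - f2 s / 2 * V.
  rewrite RintegralB// RintegralB// RintegralB// RintegralZl// RintegralZl//.
  by rewrite Rintegral_prob_cst E1 E2 mulr0 subr0.
apply: (le_trans (le_normr_Rintegral measurableT J2)).
rewrite -RintegralZl//; apply: le_Rintegral => //.
- by have := integrable_norm J2; apply: eq_integrable.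
- by have := integrableZl measurableT K I3; apply: eq_integrable.
- by move=> u _; rewrite mulrAC; exact: Tf.
Qed.

(** The heat operator: convolution with the centered Gaussian law of deviation [v]. *)
Definition gauss_op (R : realType) (v : R) (f : R -> R) (s : R) : R :=
  \int[normal_prob 0 v]_u f (s + u).

Section gauss_op.
Context {R : realType}.
Local Notation N := (@normal_prob R).
Implicit Types (v a b c K : R) (f : R -> R).

Let mshift (s : R) : measurable_fun [set: R] (fun u : R => s + u).
Proof. exact: measurable_funD. Qed.

Lemma gauss_op_integrable v K f s : bounded_lipschitz K f ->
  (N 0 v).-integrable setT (EFin \o (fun u => f (s + u))).
Proof.
move=> bf; apply: (@integrable_bounded _ _ _ (N 0 v) _ K) => [|u]; last exact: bf.1.
exact: (measurableT_comp (bounded_lipschitz_measurable bf) (mshift _)).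
Qed.

Lemma gauss_op_bounded_lipschitz v K f :
  bounded_lipschitz K f -> bounded_lipschitz K (gauss_op v f).
Proof.
move=> bf; split => [s|s t].
  apply: (@normr_Rintegral_le _ _ _ (N 0 v)) => [|u]; last exact: bf.1.
  exact: (measurableT_comp (bounded_lipschitz_measurable bf) (mshift _)).
rewrite /gauss_op -RintegralB//; [|exact: gauss_op_integrable bf..].
apply: (@normr_Rintegral_le _ _ _ (N 0 v)) => [|u].
  by apply: measurable_funB;
    exact: (measurableT_comp (bounded_lipschitz_measurable bf) (mshift _)).
by apply: (le_trans (bf.2 _ _)); rewrite opprD addrACA subrr addr0.
Qed.

Lemma gauss_op_smooth3 v K f f1 f2 : smooth3 K f f1 f2 ->
  smooth3 K (gauss_op v f) (gauss_op v f1) (gauss_op v f2).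
Proof.
move=> [b0 b1 b2 Tf]; split; [exact: gauss_op_bounded_lipschitz..|] => x y.
have I0 s := gauss_op_integrable v s b0.
have I1 s := gauss_op_integrable v s b1.
have I2 s := gauss_op_integrable v s b2.
have K1 : (N 0 v).-integrable setT (EFin \o (fun u => f1 (x + u) * y)).
  by have := integrableZr measurableT y (I1 x); apply: eq_integrable.
have K2 : (N 0 v).-integrable setT (EFin \o (fun u => f2 (x + u) * (y ^+ 2 / 2))).
  by have := integrableZr measurableT (y ^+ 2 / 2) (I2 x); apply: eq_integrable.
have J0 : (N 0 v).-integrable setT (EFin \o (fun u => f (x + y + u) - f (x + u))).
  by have := integrableB measurableT (I0 (x + y)) (I0 x); apply: eq_integrable.
have J1 : (N 0 v).-integrable setT
    (EFin \o (fun u => f (x + y + u) - f (x + u) - f1 (x + u) * y)).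
  by have := integrableB measurableT J0 K1; apply: eq_integrable.
have -> : gauss_op v f (x + y) - gauss_op v f x - gauss_op v f1 x * y -
    gauss_op v f2 x * y ^+ 2 / 2 = \int[N 0 v]_u
    (f (x + y + u) - f (x + u) - f1 (x + u) * y - f2 (x + u) * (y ^+ 2 / 2)).
  rewrite RintegralB// RintegralB// RintegralB// RintegralZr// RintegralZr//.
  by rewrite /gauss_op -mulrA.
apply: (@normr_Rintegral_le _ _ _ (N 0 v)) => [|u].
  apply: measurable_funB; last first.
    by apply: measurable_funM => //;
      exact: (measurableT_comp (bounded_lipschitz_measurable b2) (mshift _)).
  apply: measurable_funB; last first.
    by apply: measurable_funM => //;
      exact: (measurableT_comp (bounded_lipschitz_measurable b1) (mshift _)).
  by apply: measurable_funB;
      exact: (measurableT_comp (bounded_lipschitz_measurable b0) (mshift _)).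
by have := Tf (x + u) y; rewrite (addrAC x u y) -(mulrA (f2 _)).
Qed.

Lemma Rintegral_prob_shift (d : measure_display) (T : measurableType d)
    (P : probability T R) (f : T -> R) (M : R) :
  measurable_fun [set: T] f -> (forall x, `|f x| <= M) ->
  (\int[P]_x (f x + M)%:E = (\int[P]_x f x + M)%:E)%E.
Proof.
move=> mf fM; have If := integrable_bounded P mf fM.
have Ic : P.-integrable setT (EFin \o cst M) by exact: finite_measure_integrable_cst.
have J : P.-integrable setT (EFin \o (fun x => f x + M)).
  by have := integrableD measurableT If Ic; apply: eq_integrable.
rewrite -[LHS]fineK; last exact: integrable_fin_num J.
by rewrite -[fine _]/(\int[P]_x (f x + M)) RintegralD// Rintegral_prob_cst.
Qed.

Lemma gauss_opE v K f s : 0 < v -> bounded_lipschitz K f ->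
  gauss_op v f s = \int[N s v]_y f y.
Proof.
move=> v0 bf; have cf := bounded_lipschitz_continuous bf.
have mf := bounded_lipschitz_measurable bf.
have f0 y : 0 <= f y + K by have := bf.1 y; rewrite ler_norml; lra.
have cfK : continuous (fun y => f y + K).
  by move=> y; apply: continuousD; [exact: cf|exact: cvg_cst].
have cfs : continuous (fun u => f (s + u) + K).
  move=> y; apply: (@continuous_comp _ _ _ (fun u => s + u) (fun z => f z + K)).
    by apply: continuousD; [exact: cvg_cst|exact: cvg_id].
  exact: cfK.
have E1 := Rintegral_prob_shift (N s v) mf bf.1.
have E2 := @Rintegral_prob_shift _ _ (N 0 v) (fun u => f (s + u)) K
  (measurableT_comp mf (mshift s)) (fun u => bf.1 (s + u)).
have M : (\int[N 0 v]_u (f (s + u) + K)%:E = \int[N s v]_y (f y + K)%:E)%E.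
  rewrite (integral_normal_affine _ v0 cfK f0).
  rewrite (integral_normal_affine _ v0 cfs (fun u => f0 (s + u))).
  by apply: eq_integral => u _; rewrite add0r.
apply: (addIr K); apply: EFin_inj.
exact: (etrans (esym E2) (etrans M E1)).
Qed.

(** The semigroup property, from the convolution of Gaussian laws. *)
Lemma gauss_op_comp a b c K f : 0 < a -> 0 < b -> 0 < c ->
  c ^+ 2 = a ^+ 2 + b ^+ 2 -> bounded_lipschitz K f ->
  gauss_op a (gauss_op b f) = gauss_op c f.
Proof.
move=> a0 b0 c0 cE bf; apply/funext => s.
have mf := bounded_lipschitz_measurable bf; have bg := gauss_op_bounded_lipschitz b bf.
have f0 y : 0 <= f y + K by have := bf.1 y; rewrite ler_norml; lra.
have mfK : measurable_fun [set: R] (fun y => f y + K) by exact: measurable_funD.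
rewrite (gauss_opE s a0 bg) (gauss_opE s c0 bf).
have E1 := Rintegral_prob_shift (N s a) (bounded_lipschitz_measurable bg) bg.1.
have E2 := Rintegral_prob_shift (N s c) mf bf.1.
have M : (\int[N s a]_y (gauss_op b f y + K)%:E =
    \int[N s c]_y (f y + K)%:E)%E.
  rewrite -(integral_normal_conv s a0 b0 c0 cE mfK f0).
  apply: eq_integral => y _.
  have E3 := Rintegral_prob_shift (N y b) mf bf.1.
  by rewrite (gauss_opE y b0 bf); exact: (esym E3).
apply: (addIr K); apply: EFin_inj.
exact: (etrans (esym E1) (etrans M E2)).
Qed.

Lemma iter_gauss_op v K f n : 0 < v -> bounded_lipschitz K f ->
  iter n.+1 (gauss_op v) f = gauss_op (v * Num.sqrt n.+1%:R) f.
Proof.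
move=> v0 bf; elim: n => [|n IHn]; first by rewrite /= sqrtr1 mulr1.
have sq m : 0 < v * Num.sqrt m.+1%:R by rewrite mulr_gt0// sqrtr_gt0.
have E (p q : R) : 0 <= p -> 0 <= q -> p = q + 1 ->
    (v * Num.sqrt p) ^+ 2 = v ^+ 2 + (v * Num.sqrt q) ^+ 2.
  move=> p0 q0 pq.
  have sp := sqr_sqrtr p0.
  have sq' := sqr_sqrtr q0.
  rewrite (exprMn _ v (Num.sqrt p)).
  rewrite (exprMn _ v (Num.sqrt q)).
  rewrite sp sq' pq.
  by rewrite mulrDr mulr1 addrC.
have {}E := E n.+2%:R n.+1%:R (ler0n _ _) (ler0n _ _) (esym (natr1 n.+1)).
have G := gauss_op_comp v0 (sq n) (sq n.+1) E bf.
rewrite iterS.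
rewrite IHn.
exact: G.
Qed.

Lemma normal_third_moment v : 0 < v ->
  \int[N 0 v]_u `|u| ^+ 3 <= 2 * expR (9 / 2) * v ^+ 3.
Proof.
move=> v0.
(* chosen so that (|u| / v)^3 <= e^{b |u|}, with b v free of v *)
pose b := 3 / v.
have I1 := integrable_normal_expR 0 b v0.
have I2 := integrable_normal_expR 0 (- b) v0.
have E c : \int[N 0 v]_x expR (c * x) = expR (v ^+ 2 * c ^+ 2 / 2).
  by rewrite /Rintegral integral_normal_expR// mul0r add0r.
have I3 : (N 0 v).-integrable setT (EFin \o (fun u => `|u| ^+ 3)).
  apply: (@integrable_normal_expR_center _ 0 v 0 3 1) => //.
    by apply: measurable_funX; exact: normr_measurable.
  move=> u; rewrite subr0 mul1r (ger0_norm (exprn_ge0 3 (normr_ge0 u))).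
  by have := norm_expR_le 3 0 u; rewrite mul0r expR0 mulr1 addr0.
have J : (N 0 v).-integrable setT (EFin \o (fun u => expR (b * u) + expR (- b * u))).
  by have := integrableD measurableT I1 I2; apply: eq_integrable.
apply: (@le_trans _ _ (\int[N 0 v]_u (v ^+ 3 * (expR (b * u) + expR (- b * u))))).
  apply: le_Rintegral => //.
    by have := integrableZl measurableT (v ^+ 3) J; apply: eq_integrable.
  move=> u _; have -> : `|u| ^+ 3 = v ^+ 3 * `|u / v| ^+ 3.
    by rewrite normrM normfV (gtr0_norm v0); field; exact: lt0r_neq0.
  rewrite ler_wpM2l ?exprn_ge0 ?(ltW v0)//.
  have := norm_expR_le 3 0 (u / v); rewrite mul0r expR0 mulr1 addr0 => h.
  apply: (le_trans h); apply: (le_trans (expR_norm_le _ _)).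
  have e1 : 3 * (u / v) = b * u by rewrite /b mulrA mulrAC.
  by rewrite !mulNr e1.
rewrite RintegralZl// RintegralD// !E.
have v_neq0 := lt0r_neq0 v0.
rewrite (_ : v ^+ 2 * b ^+ 2 / 2 = 9 / 2); last by rewrite /b; field.
rewrite (_ : v ^+ 2 * (- b) ^+ 2 / 2 = 9 / 2); last by rewrite /b; field.
by rewrite le_eqVlt; apply/orP; left; apply/eqP; ring.
Qed.

End gauss_op.

Lemma RintegralN (d : measure_display) (T : measurableType d)
    (R : realType) (P : probability T R) (f : T -> R) :
  P.-integrable setT (EFin \o f) -> \int[P]_x (- f x) = - \int[P]_x f x.
Proof.
move=> If; rewrite -[RHS]mulN1r -RintegralZl//.
by apply: eq_Rintegral => x _; rewrite mulN1r.
Qed.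

Lemma normal_moments (R : realType) (v : R) : 0 < v ->
  [/\ (normal_prob 0 v).-integrable setT (EFin \o (fun u : R => u)),
      (normal_prob 0 v).-integrable setT (EFin \o (fun u : R => u ^+ 2)),
      (normal_prob 0 v).-integrable setT (EFin \o (fun u : R => `|u| ^+ 3)),
      \int[normal_prob 0 v]_u u = 0 & \int[normal_prob 0 v]_u (u ^+ 2) = v ^+ 2].
Proof.
move=> v0; have [E1 E2] := normal_mean_variance 0 v0.
have B (k : nat) (f : R -> R) : measurable_fun [set: R] f ->
    (forall u, `|f u| = `|u| ^+ k) ->
    (normal_prob 0 v).-integrable setT (EFin \o f).
  move=> mf fk; apply: (@integrable_normal_expR_center _ 0 v 0 k%:R 1) => // u.
  rewrite subr0 mul1r fk.
  by have := norm_expR_le k 0 u; rewrite mul0r expR0 mulr1 addr0.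
split.
- by apply: (B 1%N) => // u; rewrite expr1.
- by apply: (B 2%N) => [|u]; [exact: measurable_funX|rewrite normrX].
- apply: (B 3%N) => [|u]; first by apply: measurable_funX; exact: normr_measurable.
  by rewrite ger0_norm ?exprn_ge0.
- by rewrite -[RHS]E1; apply: eq_Rintegral => u _; rewrite subr0.
- by rewrite -E2; apply: eq_Rintegral => u _; rewrite subr0.
Qed.

Section lindeberg.
Context {d : measure_display} {T : measurableType d} {R : realType}.
Variables (P : probability T R) (x : nat -> {RV P >-> R}).
Variable F0 : probability (measurableTypeR R) R.
Hypothesis iid : iid_from x F0.

(** Telescoping: replacing the last summand by a Gaussian costs at most the constant
    below, and leaves the sum of the first [n] summands tested against [gauss_op v f],
    which is as smooth as [f]. *)
Lemma lindeberg_sum (phi : R -> R) (v K : R) (f f1 f2 : R -> R) (n : nat) :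
  measurable_fun [set: R] phi -> 0 < v ->
  F0.-integrable setT (EFin \o phi) ->
  F0.-integrable setT (EFin \o (fun u => phi u ^+ 2)) ->
  F0.-integrable setT (EFin \o (fun u => `|phi u| ^+ 3)) ->
  \int[F0]_u phi u = 0 -> \int[F0]_u (phi u ^+ 2) = v ^+ 2 ->
  smooth3 K f f1 f2 ->
  `|\int[P]_w f (partial_sum phi x n w) - iter n (gauss_op v) f 0| <=
  n%:R * (K * (\int[F0]_u `|phi u| ^+ 3 + \int[normal_prob 0 v]_u `|u| ^+ 3)).
Proof.
move=> mphi v0 I1 I2 I3 E1 E2; set D := K * _ => sf.
have [G1 G2 G3 F1 F2] := normal_moments v0.
elim: n f f1 f2 sf => [|n IHn] f f1 f2 sf.
  rewrite mul0r /=.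
  have -> : \int[P]_w f (partial_sum phi x 0 w) = f 0.
    rewrite -[RHS](Rintegral_prob_cst P); apply: eq_Rintegral => w _.
    by rewrite /partial_sum big_ord0.
  by rewrite subrr normr0.
have [bf _ _ _] := sf.
have sTf := gauss_op_smooth3 v sf; have [bTf _ _ _] := sTf.
have mf := bounded_lipschitz_measurable bf; have mTf := bounded_lipschitz_measurable bTf.
have onestep s : `|\int[F0]_u f (s + phi u) - gauss_op v f s| <= D.
  have T1 := Rintegral_taylor (Q := F0) s mphi I1 I2 I3 E1 E2 sf.
  have T2 := Rintegral_taylor (Q := normal_prob 0 v) s
    (@measurable_id _ _ setT) G1 G2 G3 F1 F2 sf.
  rewrite -/(gauss_op v f s) in T2.
  set a := \int[F0]_u f (s + phi u) in T1 *; set b := gauss_op v f s in T2 *.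
  have -> : a - b = (a - f s - f2 s / 2 * v ^+ 2) - (b - f s - f2 s / 2 * v ^+ 2).
    by ring.
  by rewrite (le_trans (ler_normB _ _))// /D mulrDr lerD.
have D0 : 0 <= D := le_trans (normr_ge0 _) (onestep 0).
have mS := measurable_partial_sum x mphi.
have Ib (h : R -> R) m : bounded_lipschitz K h ->
    P.-integrable setT (EFin \o (fun w => h (partial_sum phi x m w))).
  move=> bh; apply: (@integrable_bounded _ _ _ _ _ K) => [|w]; last exact: bh.1.
  exact: (measurableT_comp (bounded_lipschitz_measurable bh)).
have Ic : P.-integrable setT (EFin \o cst D) by exact: finite_measure_integrable_cst.
have up : \int[P]_w f (partial_sum phi x n.+1 w) <=
    \int[P]_w gauss_op v f (partial_sum phi x n w) + D.
  rewrite -[X in _ <= _ + X](Rintegral_prob_cst P) -RintegralD//; last exact: Ib.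
  apply: (partial_sum_step_le iid mphi n (M := K + D)
    (g := fun s => gauss_op v f s + D)) => //.
  - exact: measurable_funD.
  - by move=> y; rewrite (le_trans (bf.1 y))// lerDl.
  - by move=> y; rewrite (le_trans (ler_normD _ _))// lerD ?(bTf.1 y)// ger0_norm.
  - by move=> s; have := onestep s; rewrite ler_norml; lra.
have lo : \int[P]_w gauss_op v f (partial_sum phi x n w) <=
    \int[P]_w f (partial_sum phi x n.+1 w) + D.
  rewrite -lerN2 opprD lerBlDr -!RintegralN; [|exact: Ib..].
  have In : P.-integrable setT
      (EFin \o (fun w => - gauss_op v f (partial_sum phi x n w))).
    by have := integrableN (Ib _ n bTf); apply: eq_integrable.
  rewrite -[X in _ <= _ + X](Rintegral_prob_cst P) -RintegralD//.
  apply: (partial_sum_step_le iid mphi n (M := K + D)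
    (f := fun s => - f s) (g := fun s => - gauss_op v f s + D)) => //.
  - exact: measurableT_comp.
  - by apply: measurable_funD => //; exact: measurableT_comp.
  - by move=> y; rewrite normrN (le_trans (bf.1 y))// lerDl.
  - move=> y; rewrite (le_trans (ler_normD _ _))// normrN lerD ?(bTf.1 y)//.
    by rewrite ger0_norm.
  - move=> s; rewrite RintegralN; first by have := onestep s; rewrite ler_norml; lra.
    apply: (@integrable_bounded _ _ _ F0 _ K) => [|u]; last exact: bf.1.
    by apply: (measurableT_comp mf); exact: measurable_funD.
have := IHn _ _ _ sTf; rewrite iterSr -natr1 mulrDl mul1r !ler_norml.
by move: up lo; lra.
Qed.

Lemma clt_smooth (phi : R -> R) (v K : R) (f f1 f2 : R -> R) (n : nat) :
  measurable_fun [set: R] phi -> 0 < v ->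
  F0.-integrable setT (EFin \o phi) ->
  F0.-integrable setT (EFin \o (fun u => phi u ^+ 2)) ->
  F0.-integrable setT (EFin \o (fun u => `|phi u| ^+ 3)) ->
  \int[F0]_u phi u = 0 -> \int[F0]_u (phi u ^+ 2) = v ^+ 2 ->
  smooth3 K f f1 f2 ->
  `|\int[P]_w f (partial_sum phi x n.+1 w / Num.sqrt n.+1%:R) -
    \int[normal_prob 0 v]_u f u| <=
  K * (\int[F0]_u `|phi u| ^+ 3 + 2 * expR (9 / 2) * v ^+ 3) / Num.sqrt n.+1%:R.
Proof.
move=> mphi v0 I1 I2 I3 E1 E2 sf.
have [bf _ _ _] := sf.
have K0 : 0 <= K := le_trans (normr_ge0 _) (bf.1 0).
set r := Num.sqrt n.+1%:R.
have r0 : 0 < r by rewrite sqrtr_gt0.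
have r2 : r ^+ 2 = n.+1%:R by rewrite sqr_sqrtr.
have ri0 : 0 <= r^-1 by rewrite invr_ge0 ltW.
pose ps u := r^-1 * phi u.
have mps : measurable_fun [set: R] ps by exact: measurable_funM.
have J1 : F0.-integrable setT (EFin \o ps).
  by have := integrableZl measurableT r^-1 I1; apply: eq_integrable.
have e2 u : ps u ^+ 2 = r^-1 ^+ 2 * phi u ^+ 2 by rewrite exprMn.
have e3 u : `|ps u| ^+ 3 = r^-1 ^+ 3 * `|phi u| ^+ 3.
  by rewrite normrM exprMn ger0_norm.
have J2 : F0.-integrable setT (EFin \o (fun u => ps u ^+ 2)).
  have := integrableZl measurableT (r^-1 ^+ 2) I2; apply: eq_integrable => // u _.
  by rewrite /= e2.
have J3 : F0.-integrable setT (EFin \o (fun u => `|ps u| ^+ 3)).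
  have := integrableZl measurableT (r^-1 ^+ 3) I3; apply: eq_integrable => // u _.
  by rewrite /= e3.
have vr0 : 0 < v / r by rewrite divr_gt0.
have F1 : \int[F0]_u ps u = 0 by rewrite RintegralZl// E1 mulr0.
have F2 : \int[F0]_u (ps u ^+ 2) = (v / r) ^+ 2.
  under eq_Rintegral do rewrite e2.
  by rewrite RintegralZl// E2 exprMn mulrC.
have F3 : \int[F0]_u `|ps u| ^+ 3 = r^-1 ^+ 3 * \int[F0]_u `|phi u| ^+ 3.
  under eq_Rintegral do rewrite e3.
  by rewrite RintegralZl.
have := lindeberg_sum n.+1 mps vr0 J1 J2 J3 F1 F2 sf.
rewrite (iter_gauss_op n vr0 bf) -/r divfK ?gt_eqF//.
have -> : gauss_op v f 0 = \int[normal_prob 0 v]_u f u.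
  by apply: eq_Rintegral => u _; rewrite add0r.
have -> : (fun w => f (partial_sum ps x n.+1 w)) =
    (fun w => f (partial_sum phi x n.+1 w / r)).
  by apply/funext => w; rewrite /partial_sum mulr_suml; congr f;
    apply: eq_bigr => i _; rewrite mulrC.
move=> h; apply: (le_trans h); rewrite -r2 F3.
set a := \int[F0]_u `|phi u| ^+ 3.
have G := normal_third_moment vr0.
set g := \int[_]_u _ in G *.
have -> : K * (a + 2 * expR (9 / 2) * v ^+ 3) / r =
   r ^+ 2 * (K * (r^-1 ^+ 3 * a + 2 * expR (9 / 2) * (v / r) ^+ 3)).
  by field; exact: lt0r_neq0.
by rewrite ler_wpM2l ?exprn_ge0 ?(ltW r0)// ler_wpM2l// lerD2l.
Qed.

End lindeberg.

(** * Concavity of the log-likelihood; existence and uniqueness of the maximizer *)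

Section softplus.
Context {R : realType}.
Implicit Types u v : R.

Definition softplus u := ln (1 + expR u).
Definition sigmoid u := expR u / (1 + expR u).

Let e1 u : 0 < 1 + expR u. Proof. by rewrite addr_gt0// expR_gt0. Qed.

Lemma softplus_ge0 u : 0 <= softplus u.
Proof. by rewrite ln_ge0// lerDl expR_ge0. Qed.

Lemma softplus_ge u : u <= softplus u.
Proof.
by rewrite -{1}(expRK u) ler_ln ?posrE ?expR_gt0// lerDr.
Qed.

Lemma softplus_split u v : softplus v - softplus u =
  ln (1 - sigmoid u + sigmoid u * expR (v - u)).
Proof.
have e0 := e1 u; have e2 := lt0r_neq0 e0.
have -> : 1 - sigmoid u + sigmoid u * expR (v - u) = (1 + expR v) / (1 + expR u).
  have -> : expR v = expR u * expR (v - u) by rewrite -expRD addrCA subrr addr0.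
  by rewrite /sigmoid; field.
by rewrite ln_div ?posrE.
Qed.

Lemma sigmoid_itv u : 0 < sigmoid u < 1.
Proof.
by rewrite divr_gt0 ?expR_gt0//= ltr_pdivrMr// mul1r ltrDr.
Qed.

(** The mixture 1 - p + p e^h is e^{p h} times a combination of two exponentials
    whose exponents average to 0. *)
Lemma expR_mix_factor p h :
  expR (p * h) * ((1 - p) * expR (- (p * h)) + p * expR ((1 - p) * h)) =
  1 - p + p * expR h :> R.
Proof.
rewrite mulrDr [X in X + _]mulrCA [X in _ + X]mulrCA -!expRD subrr expR0 mulr1.
by have -> : p * h + (1 - p) * h = h by ring.
Qed.

(** The tangent inequality of the convex function [softplus].  It comes from
    1 + x <= e^x in both terms of [expR_mix_factor], whose first-order parts sum to 1;
    no derivative is needed, and strictness is inherited. *)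
Lemma softplus_tangent u v : softplus u + sigmoid u * (v - u) <= softplus v.
Proof.
have /andP[p0 p1] := sigmoid_itv u; set p := sigmoid u in p0 p1 *.
rewrite -lerBrDl softplus_split -/p; set h := v - u.
have q0 : 0 < 1 - p by rewrite subr_gt0.
rewrite -expR_mix_factor.
have X1 := expR_ge1Dx (- (p * h)); have X2 := expR_ge1Dx ((1 - p) * h).
have S : 1 <= (1 - p) * expR (- (p * h)) + p * expR ((1 - p) * h).
  apply: (@le_trans _ _ ((1 - p) * (1 - p * h) + p * (1 + (1 - p) * h))).
    by rewrite le_eqVlt; apply/orP; left; apply/eqP; ring.
  by apply: lerD; apply: ler_wpM2l => //; exact: ltW.
rewrite lnM ?posrE ?expR_gt0//; last exact: lt_le_trans S.
by rewrite expRK lerDl ln_ge0.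
Qed.

Lemma softplus_tangent_lt u v : u != v ->
  softplus u + sigmoid u * (v - u) < softplus v.
Proof.
move=> uv.
have /andP[p0 p1] := sigmoid_itv u; set p := sigmoid u in p0 p1 *.
rewrite -ltrBrDl softplus_split -/p; set h := v - u.
have q0 : 0 < 1 - p by rewrite subr_gt0.
have h0 : h != 0 by rewrite subr_eq0 eq_sym.
rewrite -expR_mix_factor.
have X1 := expR_ge1Dx (- (p * h)).
have X2 : 1 + (1 - p) * h < expR ((1 - p) * h).
  by apply: expR_gt1Dx; rewrite mulf_neq0// lt0r_neq0.
have S : 1 < (1 - p) * expR (- (p * h)) + p * expR ((1 - p) * h).
  apply: (@le_lt_trans _ _ ((1 - p) * (1 - p * h) + p * (1 + (1 - p) * h))).
    by rewrite le_eqVlt; apply/orP; left; apply/eqP; ring.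
  by apply: ler_ltD; [apply: ler_wpM2l => //; exact: ltW|rewrite ltr_pM2l].
rewrite lnM ?posrE ?expR_gt0//; last exact: lt_trans S.
by rewrite expRK ltrDl ln_gt0.
Qed.

Lemma softplus_mid u v : softplus ((u + v) / 2) <= (softplus u + softplus v) / 2.
Proof.
have := softplus_tangent ((u + v) / 2) u; have := softplus_tangent ((u + v) / 2) v.
have -> : v - (u + v) / 2 = (v - u) / 2 by field.
have -> : u - (u + v) / 2 = - ((v - u) / 2) by field.
by rewrite mulrN; lra.
Qed.

Lemma softplus_mid_eq u v :
  softplus ((u + v) / 2) = (softplus u + softplus v) / 2 -> u = v.
Proof.
move=> E; apply/eqP; apply/negPn/negP => uv.
have mu : (u + v) / 2 != u.
  apply/negP => /eqP e; move/eqP: uv; apply; lra.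
have := softplus_tangent_lt mu; have := softplus_tangent ((u + v) / 2) v.
have -> : v - (u + v) / 2 = (v - u) / 2 by field.
have -> : u - (u + v) / 2 = - ((v - u) / 2) by field.
by rewrite mulrN; lra.
Qed.

Lemma softplus_continuous : continuous softplus.
Proof.
move=> u; apply: (@continuous_comp _ _ _ (fun u => 1 + expR u) (@ln R)).
  by apply: continuousD; [exact: cvg_cst|exact: continuous_expR].
by apply: continuous_ln.
Qed.

End softplus.

Section loglik.
Context {R : realType}.
Variables (n : nat) (zt : 'I_n -> R) (N : nat) (z : nat -> R).

Definition loglik (ab : R * R) : R :=
  n%:R * ab.1 - \sum_(j < n) softplus (ab.1 + ab.2 * zt j)
  - \sum_(i < N) softplus (ab.1 + ab.2 * z i).

Definition score_alpha (ab : R * R) : R :=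
  n%:R - \sum_(j < n) sigmoid (ab.1 + ab.2 * zt j)
  - \sum_(i < N) sigmoid (ab.1 + ab.2 * z i).

Definition score_beta (ab : R * R) : R :=
  - (\sum_(j < n) zt j * sigmoid (ab.1 + ab.2 * zt j))
  - \sum_(i < N) z i * sigmoid (ab.1 + ab.2 * z i).

Let sum_softplus_tangent (I : finType) (y : I -> R) (ab ab' : R * R) :
  \sum_i softplus (ab.1 + ab.2 * y i) +
    (\sum_i sigmoid (ab.1 + ab.2 * y i)) * (ab'.1 - ab.1) +
    (\sum_i y i * sigmoid (ab.1 + ab.2 * y i)) * (ab'.2 - ab.2) <=
  \sum_i softplus (ab'.1 + ab'.2 * y i).
Proof.
rewrite !mulr_suml -!big_split/=; apply: ler_sum => i _.
apply: le_trans (softplus_tangent (ab.1 + ab.2 * y i) _).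
by rewrite le_eqVlt; apply/orP; left; apply/eqP; ring.
Qed.

Lemma loglik_tangent ab ab' : loglik ab' <=
  loglik ab + score_alpha ab * (ab'.1 - ab.1) + score_beta ab * (ab'.2 - ab.2).
Proof.
have := sum_softplus_tangent zt ab ab'.
have := sum_softplus_tangent (fun i : 'I_N => z i) ab ab'.
rewrite /loglik /score_alpha /score_beta.
set s1 := \sum_i softplus _; set s2 := \sum_i sigmoid _; set s3 := \sum_i _ * _.
set s4 := \sum_i _.
set t1 := \sum_i softplus _; set t2 := \sum_i sigmoid _; set t3 := \sum_i _ * _.
set t4 := \sum_i _.
by move=> h1 h2; nra.
Qed.

(** Concavity turns a first-order condition in the intercept alone into a statement
    about the slope of the maximizer: it lies on the side where the slope score
    points. *)
Lemma maximizer_score_sign ab0 ab : maximizes loglik ab0 -> score_alpha ab = 0 ->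
  0 <= score_beta ab * (ab0.2 - ab.2).
Proof.
move=> /(_ ab) m s1; have := loglik_tangent ab ab0.
by rewrite s1 mul0r addr0; lra.
Qed.

(** At the midpoint of two maximizers every convexity gap must vanish, so the two
    linear predictors agree at each majority point, and two distinct points
    determine an affine function. *)
Lemma maximizer_unique ab ab' i1 i2 : (i1 < N)%N -> (i2 < N)%N ->
  z i1 != z i2 -> maximizes loglik ab -> maximizes loglik ab' -> ab = ab'.
Proof.
move=> i1N i2N z12 m m'.
have eqL : loglik ab = loglik ab'.
  by apply/eqP; rewrite eq_le m m'.
pose mid : R * R := ((ab.1 + ab'.1) / 2, (ab.2 + ab'.2) / 2).
pose u (y : R) := ab.1 + ab.2 * y; pose v (y : R) := ab'.1 + ab'.2 * y.
have midE y : mid.1 + mid.2 * y = (u y + v y) / 2 by rewrite /mid /u /v/=; field.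
pose gap y := (softplus (u y) + softplus (v y)) / 2 - softplus ((u y + v y) / 2).
have gap0 y : 0 <= gap y by rewrite subr_ge0 softplus_mid.
have gapsum (I : finType) (y : I -> R) : \sum_i gap (y i) =
    (\sum_i softplus (u (y i)) + \sum_i softplus (v (y i))) / 2 -
    \sum_i softplus (mid.1 + mid.2 * y i).
  rewrite -big_split/= mulr_suml -sumrB; apply: eq_bigr => i _.
  by rewrite midE.
have S0 : \sum_(j < n) gap (zt j) + \sum_(i < N) gap (z i) <= 0.
  have := m mid; have := eqL; rewrite !gapsum /loglik /u /v /=.
  set s1 := \sum_(j < n) softplus _; set s2 := \sum_(i < N) softplus _.
  set t1 := \sum_(j < n) softplus _; set t2 := \sum_(i < N) softplus _.
  set r1 := \sum_(j < n) softplus _; set r2 := \sum_(i < N) softplus _.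
  by move=> h1 h2; lra.
have S1 : 0 <= \sum_(j < n) gap (zt j) by rewrite sumr_ge0.
have S2 : \sum_(i < N) gap (z i) = 0.
  apply/eqP; rewrite eq_le sumr_ge0// andbT.
  by apply: le_trans S0; rewrite lerDr.
have uvE i : (i < N)%N -> u (z i) = v (z i).
  move=> iN; apply: softplus_mid_eq.
  have /(_ (Ordinal iN) isT)/= := psumr_eq0P (fun (i : 'I_N) _ => gap0 (z i)) S2.
  by rewrite /gap => /eqP; rewrite subr_eq0 => /eqP ->.
have h1 := uvE _ i1N; have h2 := uvE _ i2N; rewrite /u /v in h1 h2.
have bE : ab.2 = ab'.2.
  have z0 : z i1 - z i2 != 0 by rewrite subr_eq0.
  by apply: (mulIf z0); lra.
have aE : ab.1 = ab'.1 by rewrite bE in h1; lra.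
by rewrite [ab]surjective_pairing [ab']surjective_pairing aE bE.
Qed.

Lemma loglik_continuous : continuous loglik.
Proof.
have sc (I : Type) (r : seq I) (y : I -> R) :
    continuous (fun ab : R * R => \sum_(i <- r) softplus (ab.1 + ab.2 * y i)).
  apply: continuous_big => [|i _ ab]; first exact: add_continuous.
  apply: (@continuous_comp _ _ _ (fun ab : R * R => ab.1 + ab.2 * y i) softplus).
    apply: continuousD; first exact: cvg_fst.
    by apply: continuousM; [exact: cvg_snd|exact: cvg_cst].
  exact: softplus_continuous.
pose l (ab : R * R) := n%:R * ab.1.
have cl : continuous l.
  by move=> ab; apply: cvgM; [exact: cvg_cst|exact: cvg_fst].
by move=> ab; exact: (continuousB (continuousB (cl ab) (sc _ _ _ ab)) (sc _ _ _ ab)).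
Qed.

(** The superlevel set of (0, 0) is bounded.  Since the minority points are centered,
    their terms cancel the linear one up to [softplus u >= u], so every linear
    predictor at a majority point is at most [K] = - loglik (0, 0); points of both
    signs then bound the slope on both sides. *)
Lemma maximizer_exists i1 i2 : (0 < n)%N -> \sum_j zt j = 0 ->
  (i1 < N)%N -> (i2 < N)%N -> 0 < z i1 -> z i2 < 0 ->
  exists ab, maximizes loglik ab.
Proof.
move=> n0 zt0 i1N i2N z1 z2.
pose K := - loglik (0, 0).
have lbound ab : loglik ab <= - \sum_(i < N) softplus (ab.1 + ab.2 * z i).
  rewrite /loglik -[leRHS]add0r lerD2r subr_le0.
  apply: (@le_trans _ _ (\sum_(j < n) (ab.1 + ab.2 * zt j))).
    by rewrite big_split/= -mulr_sumr zt0 mulr0 addr0 sumr_const card_ord mulr_natl.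
  by apply: ler_sum => j _; exact: softplus_ge.
have lbound2 ab : loglik ab <= n%:R * ab.1.
  rewrite /loglik -addrA -opprD lerBlDr lerDl addr_ge0// sumr_ge0// => i _;
  exact: softplus_ge0.
have K0 : 0 <= K by have := lbound2 (0, 0); rewrite /= mulr0 /K; lra.
have in_box ab : loglik (0, 0) <= loglik ab ->
    [/\ - K <= ab.1, ab.1 <= K, 2 * K / z i2 <= ab.2 & ab.2 <= 2 * K / z i1].
  move=> h.
  have uK i : (i < N)%N -> ab.1 + ab.2 * z i <= K.
    move=> iN; apply: (le_trans (softplus_ge _)).
    have := lbound ab; rewrite (bigD1 (Ordinal iN))//= => h2.
    have : 0 <= \sum_(i0 < N | i0 != Ordinal iN) softplus (ab.1 + ab.2 * z i0).
      by apply: sumr_ge0 => j _; exact: softplus_ge0.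
    by rewrite /K; lra.
  have u1 := uK _ i1N; have u2 := uK _ i2N.
  have a1 : - K <= ab.1.
    have n1 : 1 <= n%:R :> R by rewrite ler1n.
    have := le_trans h (lbound2 ab); rewrite -[loglik (0, 0)]opprK -/K => h3.
    by rewrite leNgt; apply/negP => h4; nra.
  split => //.
  - by rewrite leNgt; apply/negP => h4; case: (lerP 0 ab.2) => b0; nra.
  - by rewrite ler_ndivrMr//; lra.
  - by rewrite ler_pdivlMr//; lra.
pose A := `[- K, K]%classic `*` `[2 * K / z i2, 2 * K / z i1]%classic.
have A0 : A (0, 0).
  have [] := in_box (0, 0) (lexx _) => /= *.
  by split => /=; rewrite in_itv/=; apply/andP.
have [c cA maxc] : exists2 c, c \in A & forall t, t \in A -> loglik t <= loglik c.
  apply: compact_EVT_max.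
  - by exists (0, 0).
  - by apply: compact_setX; exact: segment_compact.
  - by apply: continuous_subspaceT; exact: loglik_continuous.
exists c => ab; case: (lerP (loglik (0, 0)) (loglik ab)) => h.
  apply: maxc; rewrite inE; have [] := in_box ab h => *.
  by split => /=; rewrite in_itv/=; apply/andP.
by apply: (le_trans (ltW h)); apply: maxc; rewrite inE.
Qed.

End loglik.

(** * The score along the profile curve *)

(** The left side is the sum of A / (y_i + A) with y_i = 1 / w_i.  It vanishes at
    A = 0, and by convexity in y it is at least #|I| A / (c + A), where c is the mean
    of the y_i; the upper bound on [A] is where this minorant reaches [k].  With
    k = n fixed and #|I| = n + N, it is of order 1 / N. *)
Lemma profile_equation (R : realType) (I : finType) (w : I -> R) (k : R) :
  (forall i, 0 < w i) -> 0 < k -> k < #|I|%:R ->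
  exists A, [/\ 0 < A, A <= k * (\sum_i (w i)^-1) / (#|I|%:R * (#|I|%:R - k)) &
    \sum_i (A * w i) / (1 + A * w i) = k].
Proof.
move=> w0 k0 kM; set M := #|I|%:R in kM *; set S := \sum_i (w i)^-1.
have M0 : 0 < M := lt_trans k0 kM.
have Mk : 0 < M - k by rewrite subr_gt0.
have /card_gt0P[i0 _] : (0 < #|I|)%N by rewrite -(ltr0n R).
have S0 : 0 < S.
  rewrite /S (bigD1 i0)//= ltr_pwDl ?invr_gt0// sumr_ge0// => i _.
  by rewrite invr_ge0 ltW.
set A1 := k * S / (M * (M - k)).
have A10 : 0 < A1 by rewrite divr_gt0 ?mulr_gt0.
pose g A := \sum_i (A * w i) / (1 + A * w i).
have d0 A i : 0 <= A -> 0 < 1 + A * w i.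
  by move=> A0; rewrite ltr_pwDl// mulr_ge0// ltW.
have cg : {within `[0, A1], continuous g}.
  apply: continuous_in_subspaceT => A; rewrite inE/= in_itv/= => /andP[A0 _].
  apply: (cvg_big _ (Ff := fun i B => (B * w i) / (1 + B * w i))
    (Fa := fun i => (A * w i) / (1 + A * w i))); first exact: add_continuous.
  move=> i _; have cA : (fun A => A * w i) x @[x --> A] --> A * w i.
    by apply: cvgM; [exact: cvg_id|exact: cvg_cst].
  apply: cvgM => //; apply: cvgV; first by rewrite gt_eqF// d0.
  by apply: cvgD => //; exact: cvg_cst.
have g0 : g 0 = 0 by rewrite /g big1// => i _; rewrite mul0r mul0r.
have gA1 : k <= g A1.
  pose c := S / M; have c0 : 0 < c by rewrite divr_gt0.
  have cA : 0 < c + A1 by rewrite addr_gt0.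
  have ptw i : A1 * (2 / (c + A1) - ((w i)^-1 + A1) / (c + A1) ^+ 2) <=
      (A1 * w i) / (1 + A1 * w i).
    have wi := w0 i; have wn := lt0r_neq0 wi; have di := d0 A1 i (ltW A10).
    have -> : (A1 * w i) / (1 + A1 * w i) = A1 * ((w i)^-1 + A1)^-1.
      have -> : (w i)^-1 + A1 = (1 + A1 * w i) / w i by field.
      by rewrite invf_div mulrA.
    rewrite ler_pM2l//; set y := (w i)^-1 + A1.
    have y0 : 0 < y by rewrite addr_gt0// invr_gt0.
    rewrite -subr_ge0.
    have -> : y^-1 - (2 / (c + A1) - y / (c + A1) ^+ 2) =
       (y - (c + A1)) ^+ 2 / (y * (c + A1) ^+ 2).
      by field; rewrite !lt0r_neq0.
    by rewrite divr_ge0 ?sqr_ge0// mulr_ge0 ?sqr_ge0// ltW.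
  apply: le_trans (ler_sum _ (fun i _ => ptw i)).
  have cst_sum (a : R) : \sum_(i : I) a = a * M by rewrite sumr_const mulr_natr.
  rewrite -mulr_sumr sumrB cst_sum -[X in _ - X]mulr_suml big_split/= cst_sum -/S.
  rewrite le_eqVlt; apply/orP; left; apply/eqP.
  have -> : S = c * M by rewrite /c divfK// lt0r_neq0.
  have A1E : A1 * (M - k) = k * c.
    by rewrite /A1 /c; field; rewrite !lt0r_neq0.
  have k_eq : k * (c + A1) = A1 * M by rewrite mulrDr -A1E; ring.
  have -> : A1 * (2 / (c + A1) * M - (c * M + A1 * M) / (c + A1) ^+ 2) =
     A1 * M / (c + A1) by field; exact: lt0r_neq0.
  by rewrite -k_eq mulfK// lt0r_neq0.
have [|A] := @IVT R g 0 A1 k (ltW A10) cg.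
  by rewrite g0 ge_min le_max (ltW k0) gA1 orbT.
rewrite in_itv/= => /andP[A0 AA1] gA; exists A; split => //.
rewrite lt_neqAle A0 andbT; apply/negP => /eqP A00.
by move: gA; rewrite -A00 g0 => k00; rewrite k00 ltxx in k0.
Qed.

Section profile.
Context {R : realType}.
Variables (n : nat) (zt : 'I_n -> R) (N : nat) (z : nat -> R).
Hypotheses (n0 : (0 < n)%N) (N0 : (0 < N)%N).

(** The slope score divided by - A, where A is the exponential of the intercept. *)
Definition profile_score (A b : R) : R :=
  \sum_(j < n) zt j * expR (b * zt j) / (1 + A * expR (b * zt j)) +
  \sum_(i < N) z i * expR (b * z i) / (1 + A * expR (b * z i)).

Lemma profile_exists (b : R) : exists a,
  [/\ score_alpha zt N z (a, b) = 0,
      score_beta zt N z (a, b) = - (expR a * profile_score (expR a) b) &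
      expR a <= n%:R * (\sum_(j < n) expR (- (b * zt j)) +
        \sum_(i < N) expR (- (b * z i))) / ((n%:R + N%:R) * N%:R)].
Proof.
pose w (u : 'I_n + 'I_N) := expR (b * match u with inl j => zt j | inr i => z i end).
have cardE : #|{: 'I_n + 'I_N}|%:R = n%:R + N%:R :> R.
  by rewrite card_sum !card_ord natrD.
have [||A [A0 Ale Aeq]] := @profile_equation R _ w n%:R (fun=> expR_gt0 _).
- by rewrite ltr0n.
- by rewrite cardE ltrDl ltr0n.
have sgE y : sigmoid (ln A + b * y) = (A * expR (b * y)) / (1 + A * expR (b * y)).
  by rewrite /sigmoid expRD lnK.
exists (ln A); rewrite lnK ?posrE//; split.
- rewrite /score_alpha/=; under eq_bigr do rewrite sgE.
  under [X in _ - X]eq_bigr do rewrite sgE.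
  by apply/eqP; rewrite -addrA -opprD subr_eq0 -[X in X == _]Aeq big_sumType.
- rewrite /score_beta/= /profile_score mulrDr opprD !mulr_sumr; congr (- _ - _).
    by apply: eq_bigr => j _; rewrite sgE; ring.
  by apply: eq_bigr => i _; rewrite sgE; ring.
- move: Ale; rewrite cardE big_sumType/= addrAC subrr add0r.
  by under eq_bigr do rewrite -expRN; under [X in _ + X]eq_bigr do rewrite -expRN.
Qed.

Variables (bs K : R).
Local Notation c := (2 * `|bs| + 4).
Hypothesis HK : \sum_(i < N) expR (c * `|z i|) <= K * N%:R.

Let exponent_bound (q y : R) : `|q| <= 1 -> (bs + q) * y <= (`|bs| + 1) * `|y|.
Proof.
move=> q1; apply: (le_trans (ler_norm _)); rewrite normrM ler_wpM2r//.
by rewrite (le_trans (ler_normD _ _))// lerD2l.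
Qed.

Let weight_sqr_bound (q y : R) : `|q| <= 1 ->
  `|y| * expR ((bs + q) * y) ^+ 2 <= expR (c * `|y|).
Proof.
move=> q1; have := norm_expR_le 1 (2 * (`|bs| + 1)) y; rewrite expr1 => h.
apply: (@le_trans _ _ (`|y| * expR (2 * (`|bs| + 1) * `|y|))).
  rewrite ler_wpM2l// -expRM_natr ler_expR mulrC -mulrA ler_pM2l//.
  exact: exponent_bound.
apply: (le_trans h); rewrite ler_expR ler_wpM2r//; lra.
Qed.

Let weight_taylor_bound (q y : R) : `|q| <= 1 ->
  `|y * expR ((bs + q) * y) - y * expR (bs * y) - q * (y ^+ 2 * expR (bs * y))|
    <= q ^+ 2 * expR (c * `|y|).
Proof.
move=> q1.
have -> : y * expR ((bs + q) * y) - y * expR (bs * y) -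
    q * (y ^+ 2 * expR (bs * y)) =
    y * expR (bs * y) * (expR (q * y) - 1 - q * y).
  by rewrite mulrDl expRD; ring.
rewrite !normrM (ger0_norm (expR_ge0 _)).
apply: (@le_trans _ _ (`|y| * expR (`|bs| * `|y|) * (q ^+ 2 * `|y| ^+ 2 * expR `|y|))).
  apply: ler_pM => //.
    by rewrite ler_wpM2l// ler_expR -normrM ler_norm.
  apply: (le_trans (expR_taylor2 _)); rewrite normrM exprMn real_normK ?num_real//.
  by rewrite ler_wpM2l ?(mulr_ge0 (sqr_ge0 q) (sqr_ge0 `|y|))// ler_expR ler_piMl.
have -> : `|y| * expR (`|bs| * `|y|) * (q ^+ 2 * `|y| ^+ 2 * expR `|y|) =
   q ^+ 2 * (`|y| ^+ 3 * expR ((`|bs| + 1) * `|y|)).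
  by rewrite mulrDl mul1r expRD; ring.
rewrite ler_wpM2l ?sqr_ge0//; apply: (le_trans (norm_expR_le _ _ _)).
by rewrite ler_expR ler_wpM2r//; have := normr_ge0 bs; lra.
Qed.

(** The error has three sources: the minority terms, the denominators 1 + A w, which
    cost A |z| w^2, and the second-order term in [q].  One exponential envelope of
    rate 2 |bs| + 4 dominates the last two for all |q| <= 1. *)
Lemma profile_score_expansion (q A E1 D : R) : `|q| <= 1 -> 0 <= A ->
  A * N%:R <= D ->
  \sum_(j < n) `|zt j| * expR ((bs + q) * zt j) <= E1 ->
  `|profile_score A (bs + q) - \sum_(i < N) z i * expR (bs * z i) -
    q * \sum_(i < N) (z i ^+ 2 * expR (bs * z i))| <=
  E1 + D * K + q ^+ 2 * N%:R * K.
Proof.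
move=> q1 A0 AD hE.
have K0 : 0 <= K.
  have : 0 <= K * N%:R.
    by apply: le_trans HK; apply: sumr_ge0 => i _; exact: expR_ge0.
  by rewrite pmulr_lge0// ltr0n.
have den y : 1 <= 1 + A * expR ((bs + q) * y) by rewrite lerDl mulr_ge0// expR_ge0.
pose w y := expR ((bs + q) * y).
pose r y := y * w y / (1 + A * w y) - y * w y.
pose r2 y := y * w y - y * expR (bs * y) - q * (y ^+ 2 * expR (bs * y)).
have -> : profile_score A (bs + q) - \sum_(i < N) z i * expR (bs * z i) -
    q * \sum_(i < N) (z i ^+ 2 * expR (bs * z i)) =
    \sum_(j < n) zt j * w (zt j) / (1 + A * w (zt j)) +
    \sum_(i < N) r (z i) + \sum_(i < N) r2 (z i).
  rewrite /profile_score /r /r2 !sumrB -mulr_sumr -/w.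
  by rewrite -/(w _); ring.
apply: (le_trans (ler_normD _ _)); apply: lerD; last first.
  apply: (le_trans (ler_norm_sum _ _ _)).
  apply: (@le_trans _ _ (\sum_(i < N) q ^+ 2 * expR (c * `|z i|))).
    by apply: ler_sum => i _; exact: weight_taylor_bound.
  rewrite -mulr_sumr -mulrA ler_wpM2l ?sqr_ge0//.
  by rewrite (mulrC N%:R K).
apply: (le_trans (ler_normD _ _)); apply: lerD.
  apply: le_trans hE; apply: (le_trans (ler_norm_sum _ _ _)).
  apply: ler_sum => j _; rewrite !normrM (ger0_norm (expR_ge0 _)).
  rewrite ler_piMr ?mulr_ge0 ?expR_ge0//.
  have d1 := den (zt j); have d0 := lt_le_trans ltr01 d1.
  by rewrite normfV (gtr0_norm d0) invf_le1.
apply: (le_trans (ler_norm_sum _ _ _)).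
apply: (@le_trans _ _ (\sum_(i < N) A * expR (c * `|z i|))).
  apply: ler_sum => i _.
  have d1 := den (z i); have d0 := lt_le_trans ltr01 d1.
  have -> : r (z i) = - (A * (z i * w (z i) ^+ 2) / (1 + A * w (z i))).
    by rewrite /r /w; field; exact: lt0r_neq0.
  rewrite normrN normrM normfV (gtr0_norm d0) ler_pdivrMr//.
  rewrite normrM (ger0_norm A0) normrM (ger0_norm (sqr_ge0 _)).
  apply: (@le_trans _ _ (A * expR (c * `|z i|))).
    by rewrite ler_wpM2l//; exact: weight_sqr_bound.
  by rewrite ler_peMr// mulr_ge0// expR_ge0.
rewrite -mulr_sumr; apply: (@le_trans _ _ (A * (K * N%:R))).
  by rewrite ler_wpM2l.
by rewrite mulrCA mulrC ler_wpM2r.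
Qed.

End profile.

(** * Localization of the maximizer *)

Section localization.
Context {R : realType}.
Variables (n : nat) (zt : 'I_n -> R) (N : nat) (z : nat -> R).
Hypotheses (n0 : (0 < n)%N) (N0 : (0 < N)%N) (zt0 : \sum_j zt j = 0).
Variables (Bt bs K J M eta eps : R).
Local Notation c := (2 * `|bs| + 4).
Local Notation s := (Num.sqrt (N%:R : R)).
Local Notation y1 := (\sum_(i < N) z i * expR (bs * z i)).
Local Notation y2 := (\sum_(i < N) z i ^+ 2 * expR (bs * z i)).
Let W : R := - (y1 / (J * s)).
Hypothesis HBt : forall j, `|zt j| <= Bt.
Hypotheses (J0 : 0 < J) (eta0 : 0 < eta) (K0 : 0 < K).
Hypothesis HK : \sum_(i < N) expR (c * `|z i|) <= K * N%:R.
Hypothesis HW : `|W| <= M.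
Hypothesis HJ : `|y2 / N%:R - J| <= eps.
Let E : R := expR ((`|bs| + 1) * Bt).
Let D : R := n%:R * (n%:R * E + K).
Hypothesis small1 : (M + eta) * eps <= J * eta / 4.
Hypothesis small2 : eps <= J / 2.
Hypothesis small3 :
  n%:R * (Bt * E) + D * K + (M + eta) ^+ 2 * K <= J * eta / 4 * s.
Hypothesis small4 : M + eta <= s.
Hypothesis small5 : K * M < J / 4 * s.

Let s0 : 0 < s. Proof. by rewrite sqrtr_gt0 ltr0n. Qed.
Let s2 : s ^+ 2 = N%:R. Proof. by rewrite sqr_sqrtr. Qed.
Let NR : 0 < N%:R :> R. Proof. by rewrite ltr0n. Qed.
Let M0 : 0 <= M. Proof. exact: le_trans (normr_ge0 _) HW. Qed.
Let y1E : y1 = - (J * s * W).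
Proof. by rewrite /W mulrN opprK mulrC divfK// mulf_neq0 ?lt0r_neq0. Qed.

(** Divided by sqrt N, the score is an affine function of t with slope J and zero W,
    up to J eta / 2; the hypotheses [small1], [small3] and [small4] are what this
    requires of eps and N. *)
Lemma profile_score_near (t : R) : `|t| <= M + eta ->
  exists a A, [/\ 0 < A, score_alpha zt N z (a, bs + t / s) = 0,
    score_beta zt N z (a, bs + t / s) = - (A * profile_score zt N z A (bs + t / s)) &
    `|profile_score zt N z A (bs + t / s) / s - J * (t - W)| <= J * eta / 2].
Proof.
move=> tM; set q := t / s.
have q1 : `|q| <= 1.
  by rewrite normrM normfV (gtr0_norm s0) ler_pdivrMr// mul1r (le_trans tM).
have exponent_bound y : (bs + q) * y <= (`|bs| + 1) * `|y|.
  apply: (le_trans (ler_norm _)); rewrite normrM ler_wpM2r//.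
  by rewrite (le_trans (ler_normD _ _))// lerD2l.
have [a [S1 S2 Ale]] := profile_exists zt z n0 N0 (bs + q).
exists a, (expR a); split => //; first exact: expR_gt0.
have ztE j : expR ((bs + q) * zt j) <= E.
  by rewrite ler_expR (le_trans (exponent_bound _))// ler_wpM2l.
have ztE' j : expR (- ((bs + q) * zt j)) <= E.
  by rewrite -mulrN ler_expR (le_trans (exponent_bound _))// normrN ler_wpM2l.
have E0 : 0 <= E := expR_ge0 _.
have AD : expR a * N%:R <= D.
  have nN : 0 < n%:R + N%:R :> R by rewrite ltr_wpDl.
  have h1 : \sum_(j < n) expR (- ((bs + q) * zt j)) <= n%:R * E.
    apply: (@le_trans _ _ (\sum_(j < n) E)); first exact: ler_sum.
    by rewrite sumr_const card_ord mulr_natl.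
  have h2 : \sum_(i < N) expR (- ((bs + q) * z i)) <= K * N%:R.
    apply: le_trans HK; apply: ler_sum => i _.
    rewrite -mulrN ler_expR (le_trans (exponent_bound _))// normrN ler_wpM2r//.
    by have := normr_ge0 bs; lra.
  apply: (@le_trans _ _ (n%:R * (n%:R * E + K * N%:R) / (n%:R + N%:R))).
    rewrite -ler_pdivlMr//; apply: (le_trans Ale).
    rewrite invfM mulrA ler_wpM2r ?invr_ge0 ?ler0n//.
    rewrite ler_wpM2r ?invr_ge0 ?(ltW nN)// ler_wpM2l// lerD//.
  rewrite ler_pdivrMr// /D -[leRHS]mulrA ler_wpM2l//.
  have n1 : 1 <= n%:R :> R by rewrite ler1n.
  have N1 : 1 <= N%:R :> R by rewrite ler1n.
  have p1 : 0 <= n%:R * E by rewrite mulr_ge0.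
  have p2 : 0 <= K * n%:R by rewrite mulr_ge0// ltW.
  have p3 : n%:R * E <= n%:R * E * (n%:R + N%:R) by rewrite ler_peMr//; lra.
  have -> : (n%:R * E + K) * (n%:R + N%:R) =
    n%:R * E * (n%:R + N%:R) + K * n%:R + K * N%:R by ring.
  by rewrite lerD2r (le_trans p3)// lerDl.
have E1 : \sum_(j < n) `|zt j| * expR ((bs + q) * zt j) <= n%:R * (Bt * E).
  apply: (@le_trans _ _ (\sum_(j < n) Bt * E)).
    by apply: ler_sum => j _; apply: ler_pM => //; exact: expR_ge0.
  by rewrite sumr_const card_ord mulr_natl.
have := profile_score_expansion N0 HK q1 (expR_ge0 a) AD E1.
set PS := profile_score _ _ _ _ _.
have q2 : q ^+ 2 * N%:R * K <= (M + eta) ^+ 2 * K.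
  rewrite ler_wpM2r ?(ltW K0)// /q expr_div_n s2 divfK ?lt0r_neq0//.
  by rewrite -real_normK ?num_real// lerXn2r ?nnegrE// addr_ge0// ltW.
move=> h; have {}h : `|PS - y1 - q * y2| <= J * eta / 4 * s.
  by apply: (le_trans h); apply: le_trans small3; rewrite lerD2l.
pose dJ := y2 / N%:R - J.
have y2E : q * y2 = s * (t * (J + dJ)).
  have y2N : y2 = (J + dJ) * s ^+ 2.
    by rewrite s2 /dJ addrC subrK divfK// lt0r_neq0.
  by rewrite y2N /q; field; exact: lt0r_neq0.
have tdJ : `|t * dJ| <= J * eta / 4.
  rewrite normrM; apply: le_trans small1; apply: ler_pM => //.
have -> : PS / s - J * (t - W) = (PS - y1 - q * y2) / s + t * dJ.
  by rewrite y2E y1E; field; exact: lt0r_neq0.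
apply: (le_trans (ler_normD _ _)).
have h3 : `|(PS - y1 - q * y2) / s| <= J * eta / 4.
  by rewrite normrM normfV (gtr0_norm s0) ler_pdivrMr.
by lra.
Qed.

(** At t = W + eta the affine approximation is J eta, beyond the error, so the sign of
    the score is known; likewise at t = W - eta. *)
Lemma maximizer_near (ab : R * R) : maximizes (loglik zt N z) ab ->
  `|s * (ab.2 - bs) - W| <= eta.
Proof.
move=> mab; move: HW; rewrite ler_norml => /andP[W1 W2].
have e0 := eta0; have Je : 0 < J * eta by rewrite mulr_gt0.
have gen t : ab.2 - (bs + t / s) = (s * (ab.2 - bs) - t) / s.
  by field; exact: lt0r_neq0.
rewrite ler_norml; apply/andP; split.
- have [|a [A [A0 S1 S2 near]]] := @profile_score_near (W - eta).
    by rewrite ler_norml; lra.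
  have := maximizer_score_sign mab S1; rewrite S2 gen /=.
  move: near; set PS := profile_score _ _ _ _ _.
  rewrite ler_norml (_ : J * (W - eta - W) = - (J * eta)); last by ring.
  move=> /andP[_ h] h2.
  have PS0 : PS / s < 0 by lra.
  rewrite pmulr_llt0 ?invr_gt0// in PS0.
  have c0 : 0 < - (A * PS) by rewrite oppr_gt0 pmulr_rlt0.
  by move: h2; rewrite pmulr_rge0// pmulr_lge0 ?invr_gt0//; lra.
- have [|a [A [A0 S1 S2 near]]] := @profile_score_near (W + eta).
    by rewrite ler_norml; lra.
  have := maximizer_score_sign mab S1; rewrite S2 gen /=.
  move: near; set PS := profile_score _ _ _ _ _.
  rewrite ler_norml (_ : J * (W + eta - W) = J * eta); last by ring.
  move=> /andP[h _] h2.
  have PS0 : 0 < PS / s by lra.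
  rewrite pmulr_lgt0 ?invr_gt0// in PS0.
  have c0 : - (A * PS) < 0 by rewrite oppr_lt0 mulr_gt0.
  by move: h2; rewrite nmulr_rge0// pmulr_lle0 ?invr_gt0//; lra.
Qed.

(** If all z_i had the same sign, the first moment y1, which is of order sqrt N, would
    be the absolute one.  Interpolating the second moment between the first and the
    third would then make it too small; the weight [l] balances the two terms. *)
Let covariates_change_sign :
  \sum_(i < N) `|z i| * expR (bs * z i) <> `|y1|.
Proof.
move=> same.
pose l := 2 * K / J.
have l0 : 0 < l by rewrite divr_gt0// mulr_gt0.
have ptw i : z i ^+ 2 * expR (bs * z i) <=
    l / 2 * (`|z i| * expR (bs * z i)) + (2 * l)^-1 * expR (c * `|z i|).
  have e0 := expR_gt0 (bs * z i).
  have h1 : `|z i| ^+ 3 * expR (bs * z i) <= expR (c * `|z i|).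
    apply: (@le_trans _ _ (`|z i| ^+ 3 * expR (`|bs| * `|z i|))).
      by rewrite ler_wpM2l ?exprn_ge0// ler_expR -normrM ler_norm.
    apply: (le_trans (norm_expR_le _ _ _)); rewrite ler_expR ler_wpM2r//.
    by have := normr_ge0 bs; lra.
  have li : 0 <= (2 * l)^-1 by rewrite invr_ge0 mulr_ge0// ltW.
  apply: (@le_trans _ _ (l / 2 * (`|z i| * expR (bs * z i)) +
    (2 * l)^-1 * (`|z i| ^+ 3 * expR (bs * z i)))); last first.
    by rewrite lerD2l ler_wpM2l.
  rewrite -subr_ge0 -(real_normK (num_real (z i))).
  set a := `|z i|.
  have -> : l / 2 * (a * expR (bs * z i)) + (2 * l)^-1 * (a ^+ 3 * expR (bs * z i))
    - a ^+ 2 * expR (bs * z i) = expR (bs * z i) * a * (l - a) ^+ 2 * (2 * l)^-1.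
    by field; exact: lt0r_neq0.
  exact: mulr_ge0 (mulr_ge0 (mulr_ge0 (ltW e0) (normr_ge0 _)) (sqr_ge0 _)) li.
have y2b : y2 <= l / 2 * (J * s * M) + (2 * l)^-1 * (K * N%:R).
  apply: (@le_trans _ _ (\sum_(i < N) (l / 2 * (`|z i| * expR (bs * z i)) +
     (2 * l)^-1 * expR (c * `|z i|)))); first exact: ler_sum.
  rewrite big_split/= -!mulr_sumr same lerD//.
    have l2 : 0 <= l / 2 by rewrite divr_ge0// ltW.
    apply: (ler_wpM2l l2); rewrite y1E normrN normrM gtr0_norm ?mulr_gt0//.
    by apply: ler_wpM2l => //; rewrite mulr_ge0// ltW.
  by rewrite ler_wpM2l// invr_ge0 mulr_ge0// ltW.
have y2lb : J / 2 * s ^+ 2 <= y2.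
  by rewrite s2 -ler_pdivlMr//; move: HJ small2; rewrite ler_norml; lra.
have e1 : l / 2 * (J * s * M) = K * M * s.
  by rewrite /l; field; exact: lt0r_neq0.
have e2 : (2 * l)^-1 * (K * N%:R) = J / 4 * s ^+ 2.
  by rewrite /l s2; field; rewrite !lt0r_neq0.
have : K * M * s < J / 4 * s * s by rewrite ltr_pM2r.
move: (le_trans y2lb y2b); rewrite e1 e2 expr2; lra.
Qed.

Lemma maximizer_exists_unique : exists! ab, maximizes (loglik zt N z) ab.
Proof.
have [i1 i1N z1] : exists2 i, (i < N)%N & 0 < z i.
  apply: contrapT => H; apply: covariates_change_sign.
  have zn (i : 'I_N) : z i <= 0.
    by rewrite leNgt; apply/negP => zi; apply: H; exists (val i); rewrite ?ltn_ord.
  rewrite ler0_norm; last first.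
    by apply: sumr_le0 => i _; rewrite mulr_le0_ge0// expR_ge0.
  by rewrite -sumrN; apply: eq_bigr => i _; rewrite ler0_norm// mulNr.
have [i2 i2N z2] : exists2 i, (i < N)%N & z i < 0.
  apply: contrapT => H; apply: covariates_change_sign.
  have zn (i : 'I_N) : 0 <= z i.
    by rewrite leNgt; apply/negP => zi; apply: H; exists (val i); rewrite ?ltn_ord.
  rewrite ger0_norm; last first.
    by apply: sumr_ge0 => i _; rewrite mulr_ge0// expR_ge0.
  by apply: eq_bigr => i _; rewrite ger0_norm.
have [ab mab] := maximizer_exists n0 zt0 i1N i2N z1 z2.
exists ab; split => // ab' mab'.
apply: (maximizer_unique i1N i2N _ mab mab').
by rewrite gt_eqF// (lt_trans z2).
Qed.

End localization.

(** * Influence function and asymptotic normality *)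

Lemma coupling_bound (d : measure_display) (T : measurableType d) (R : realType)
    (P : probability T R) (f g : T -> R) (B : set T) (M e p : R) :
  measurable_fun [set: T] f -> measurable_fun [set: T] g -> measurable B ->
  (forall w, `|f w| <= M) -> (forall w, `|g w| <= M) -> 0 <= e ->
  (forall w, ~ B w -> `|f w - g w| <= e) -> (P B <= p%:E)%E ->
  `|\int[P]_w f w - \int[P]_w g w| <= e + 2 * M * p.
Proof.
move=> mf mg mB fM gM e0 fg PB.
have If := integrable_bounded P mf fM; have Ig := integrable_bounded P mg gM.
have Ifg : P.-integrable setT (EFin \o (fun w => f w - g w)).
  by have := integrableB measurableT If Ig; apply: eq_integrable.
have IB : P.-integrable setT (EFin \o (\1_B : T -> R)).
  apply: (@integrable_bounded _ _ _ _ _ 1) => // w.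
  by rewrite indicE; case: (_ \in _); rewrite ?normr1 ?normr0.
have IMB : P.-integrable setT (EFin \o (fun w => 2 * M * \1_B w)).
  by have := integrableZl measurableT (2 * M) IB; apply: eq_integrable.
have Ie : P.-integrable setT (EFin \o cst e) by exact: finite_measure_integrable_cst.
have IR : P.-integrable setT (EFin \o (fun w => e + 2 * M * \1_B w)).
  by have := integrableD measurableT Ie IMB; apply: eq_integrable.
rewrite -RintegralB//.
apply: (le_trans (le_normr_Rintegral measurableT Ifg)).
apply: (@le_trans _ _ (\int[P]_w (e + 2 * M * \1_B w))).
  apply: le_Rintegral => //.
    by have := integrable_norm Ifg; apply: eq_integrable.
  move=> w _; rewrite indicE; case: (boolP (w \in B)) => [wB|].
    rewrite mulr1 (le_trans (ler_normB _ _))//.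
    by have := fM w; have := gM w; lra.
  by rewrite notin_setE => /fg; rewrite mulr0 addr0.
have M0 : 0 <= M := le_trans (normr_ge0 _) (normr_Rintegral_le P mf fM).
rewrite RintegralD// RintegralZl// Rintegral_prob_cst lerD2l.
rewrite ler_wpM2l ?mulr_ge0// /Rintegral.
rewrite [X in fine X](_ : _ = P B); last by rewrite integral_indic// setIT.
by rewrite -lee_fin fineK// fin_num_measure.
Qed.

Section normal_score.
Context {R : realType}.
Variables (mu sigma b a : R).
Hypotheses (sigma0 : 0 < sigma) (ba : mu + sigma ^+ 2 * b = a).
Let F0 : probability (measurableTypeR R) R := normal_prob mu sigma.
Let E0 := \int[F0]_u (expR (b * u) * (u - a) ^+ 2).

(** The derivative of the limiting slope score b |-> E[z e^{b z}]. *)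
Definition score_information :=
  \int[F0]_u ((u - a) ^+ 2 * expR (b * (u - a))).

Let mc : measurable_fun [set: R] (fun u : R => u - a).
Proof. exact: measurable_funB. Qed.

Lemma measurable_tilted (k : nat) (g : R) :
  measurable_fun [set: R] (fun u => (u - a) ^+ k * expR (g * (u - a))).
Proof.
apply: measurable_funM; first exact: measurable_funX.
by apply: measurableT_comp => //; exact: measurable_funM.
Qed.

Lemma integrable_tilted (k : nat) (g : R) :
  F0.-integrable setT (EFin \o (fun u => (u - a) ^+ k * expR (g * (u - a)))).
Proof.
apply: (@integrable_normal_expR_center _ mu sigma a (k%:R + `|g|) 1) => //.
- exact: measurable_tilted.
move=> u; rewrite mul1r normrM normrX (ger0_norm (expR_ge0 _)).
apply: le_trans (norm_expR_le k `|g| (u - a)).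
by rewrite ler_wpM2l ?exprn_ge0// ler_expR -normrM ler_norm.
Qed.

Lemma score_informationE : score_information = expR (- (b * a)) * E0.
Proof.
rewrite /score_information /E0 -RintegralZl//; last exact: integrable_tilted_square.
by apply: eq_Rintegral => u _; rewrite mulrA -expRD mulrC; congr (expR _ * _); ring.
Qed.

Lemma score_information_gt0 : 0 < score_information.
Proof.
rewrite score_informationE mulr_gt0 ?expR_gt0// /E0.
rewrite normal_tilted_second_moment// mulr_gt0 ?expR_gt0//.
by rewrite ltr_wpDl ?sqr_ge0// exprn_gt0.
Qed.

(** This is the equation defining the limit slope, rewritten for centered
    observations. *)
Lemma score_mean0 : \int[F0]_u ((u - a) * expR (b * (u - a))) = 0.
Proof.
have Iu : F0.-integrable setT (EFin \o (fun u => expR (b * u) * u)).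
  have I1 := integrableZl measurableT (expR (b * a)) (integrable_tilted 1 b).
  have I0 := integrableZl measurableT a (integrable_normal_expR mu b sigma0).
  have := integrableD measurableT I1 I0; apply: eq_integrable => // u _ /=.
  rewrite -!EFinM -EFinD expr1; congr EFin.
  have -> : expR (b * u) = expR (b * a) * expR (b * (u - a)).
    by rewrite -expRD; congr expR; ring.
  by ring.
have Ie := integrable_normal_expR mu b sigma0.
have tm := normal_tilted_mean mu b sigma0.
rewrite /tilted_mean ba in tm.
have e0 : 0 < \int[F0]_x expR (b * x).
  by rewrite /Rintegral integral_normal_expR// expR_gt0.
have {}tm : \int[F0]_x (expR (b * x) * x) = a * \int[F0]_x expR (b * x).
  by rewrite -tm divfK// gt_eqF.
transitivity (\int[F0]_u (expR (- (b * a)) *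
    (expR (b * u) * u - a * expR (b * u)))).
  apply: eq_Rintegral => u _.
  have -> : expR (b * (u - a)) = expR (- (b * a)) * expR (b * u).
    by rewrite -expRD; congr expR; ring.
  by ring.
have Ia : F0.-integrable setT (EFin \o (fun u => a * expR (b * u))).
  by have := integrableZl measurableT a Ie; apply: eq_integrable.
rewrite RintegralZl//.
  by rewrite RintegralB// RintegralZl// tm subrr mulr0.
by have := integrableB measurableT Iu Ia; apply: eq_integrable.
Qed.

(** The contribution of one majority observation to the linearized estimator. *)
Definition influence u := - ((u - a) * expR (b * (u - a)) / score_information).

Let J := score_information.
Let Ji : 0 <= J^-1. Proof. by rewrite invr_ge0 ltW// score_information_gt0. Qed.

Lemma measurable_influence : measurable_fun [set: R] influence.
Proof.
apply: measurableT_comp => //; apply: measurable_funM => //.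
by have := measurable_tilted 1 b; apply: eq_measurable_fun => u _; rewrite expr1.
Qed.

Let influenceX (k : nat) u : `|influence u| ^+ k =
  J^-1 ^+ k * `|(u - a) ^+ k * expR ((k%:R * b) * (u - a))|.
Proof.
rewrite /influence normrN normrM (ger0_norm Ji) exprMn mulrC; congr (_ * _).
rewrite !normrM exprMn normrX !(ger0_norm (expR_ge0 _)) -expRM_natr.
by congr (_ * expR _); ring.
Qed.

Lemma influence_integrable :
  [/\ F0.-integrable setT (EFin \o influence),
      F0.-integrable setT (EFin \o (fun u => influence u ^+ 2)) &
      F0.-integrable setT (EFin \o (fun u => `|influence u| ^+ 3))].
Proof.
have I (k : nat) (f : R -> R) : measurable_fun [set: R] f ->
    (forall u, `|f u| = `|influence u| ^+ k) -> F0.-integrable setT (EFin \o f).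
  move=> mf fk.
  have := integrableZl measurableT (J^-1 ^+ k)
    (integrable_norm (integrable_tilted k (k%:R * b))).
  apply: le_integrable => //; first exact/measurable_EFinP.
  move=> u _; rewrite /= lee_fin fk influenceX; exact: ler_norm.
have mi := measurable_influence.
split; [apply: (I 1%N)|apply: (I 2%N)|apply: (I 3%N)] => //.
- exact: measurable_funX.
- by move=> u; rewrite normrX.
- by apply: measurable_funX; exact: measurableT_comp.
- by move=> u; rewrite ger0_norm ?exprn_ge0.
Qed.

Lemma influence_mean0 : \int[F0]_u influence u = 0.
Proof.
transitivity (\int[F0]_u (- J^-1 * ((u - a) * expR (b * (u - a))))).
  by apply: eq_Rintegral => u _; rewrite /influence mulNr mulrC.
rewrite RintegralZl//; first by rewrite score_mean0 mulr0.
by have := integrable_tilted 1 b; apply: eq_integrable => // u _; rewrite /= expr1.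
Qed.

Lemma influence_variance :
  \int[F0]_u (influence u ^+ 2) = asymptotic_variance F0 b a.
Proof.
rewrite /asymptotic_variance.
rewrite mulrC -RintegralZl//; last exact: integrable_tilted_square.
apply: eq_Rintegral => u _.
rewrite /influence score_informationE -/E0.
have e0 : E0 != 0.
  apply: contraTneq score_information_gt0 => E00.
  by rewrite score_informationE E00 mulr0 ltxx.
have -> : expR (2 * b * u) = expR (b * (u - a)) ^+ 2 / expR (- (b * a)) ^+ 2.
  by rewrite -!expRM_natr -expRN -expRD; congr expR; ring.
by field; rewrite e0 lt0r_neq0 ?expR_gt0.
Qed.

End normal_score.

Lemma centered_moments (d : measure_display) (T : measurableType d) (R : realType)
    (Q : probability T R) (f : T -> R) :
  measurable_fun [set: T] f -> Q.-integrable setT (EFin \o f) ->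
  Q.-integrable setT (EFin \o (fun u => f u ^+ 2)) ->
  let g u := f u - \int[Q]_v f v in
  [/\ measurable_fun [set: T] g, Q.-integrable setT (EFin \o g),
      Q.-integrable setT (EFin \o (fun u => g u ^+ 2)) & \int[Q]_u g u = 0].
Proof.
move=> mf I1 I2; set e := \int[Q]_v f v => g.
have Ic k : Q.-integrable setT (EFin \o cst k).
  exact: finite_measure_integrable_cst.
split.
- exact: measurable_funB.
- by have := integrableB measurableT I1 (Ic e); apply: eq_integrable.
- have I3 := integrableZl measurableT (- 2 * e) I1.
  have := integrableD measurableT (integrableD measurableT I2 I3) (Ic (e ^+ 2)).
  apply: eq_integrable => // u _ /=.
  by rewrite -EFinM -!EFinD; congr EFin; rewrite /g; ring.
- have -> : \int[Q]_u g u = \int[Q]_u f u - \int[Q]__ e.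
    exact: (RintegralB measurableT I1 (Ic e)).
  by rewrite Rintegral_prob_cst subrr.
Qed.

Lemma measurable_tail_set (d : measure_display) (T : measurableType d)
    (R : realType) (X : T -> R) (k : R) :
  measurable_fun [set: T] X -> measurable [set w | k <= `|X w|].
Proof.
move=> mX; have mn : measurable_fun [set: T] (fun w => `|X w|).
  exact: measurableT_comp.
have := mn measurableT `[k, +oo[%classic (measurable_itv _).
by rewrite setTI; congr (measurable _); apply/seteqP; split => w /=;
  rewrite in_itv/= andbT.
Qed.

Section asymptotic_normality.
Context {d : measure_display} {T : measurableType d} {R : realType}.
Variables (P : probability T R) (mu sigma : R) (n : nat) (xt : 'I_n -> R).
Variables (x : nat -> {RV P >-> R}) (b : R).
Variables (alpha : nat -> T -> R) (beta : nat -> {RV P >-> R}).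
Let a := sample_mean xt.
Let F0 : probability (measurableTypeR R) R := normal_prob mu sigma.
Hypotheses (sigma0 : 0 < sigma) (n0 : (0 < n)%N).
Hypothesis iid : iid_from x F0.
Hypothesis ba : mu + sigma ^+ 2 * b = a.
Hypothesis mle : forall (N : nat) (w : T),
  let L := centered_loglik xt N (fun i => x i w) in
  (exists! ab : R * R, maximizes L ab) -> maximizes L (alpha N w, beta N w).

Let J := score_information mu sigma b a.
Let J0 : 0 < J. Proof. exact: score_information_gt0. Qed.
Let phi := influence mu sigma b a.
Let c := 2 * `|b| + 4.
Let info (u : R) := (u - a) ^+ 2 * expR (b * (u - a)).
Let envelope (u : R) := expR (c * `|u - a|).
Let info_dev u := info u - \int[F0]_v info v.
Let envelope_dev u := envelope u - \int[F0]_v envelope v.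
Let K := \int[F0]_v envelope v + 1.
Local Notation s N := (Num.sqrt (N%:R : R)).

Let c0 : 0 <= c. Proof. by rewrite addr_ge0// mulr_ge0. Qed.

Let info_dev_moments : [/\ measurable_fun [set: R] info_dev,
  F0.-integrable setT (EFin \o info_dev),
  F0.-integrable setT (EFin \o (fun u => info_dev u ^+ 2)) & \int[F0]_u info_dev u = 0].
Proof.
apply: (@centered_moments _ _ _ F0 info); first exact: measurable_tilted.
  exact: integrable_tilted.
have := @integrable_tilted R mu sigma a sigma0 4 (2 * b).
apply: eq_integrable => // u _; rewrite /= /info exprMn -exprM -expRM_natr.
by congr ((_ * expR _)%:E); ring.
Qed.

Let measurable_envelope : measurable_fun [set: R] envelope.
Proof.
apply: measurableT_comp => //; apply: measurable_funM => //.
by apply: measurableT_comp => //; exact: measurable_funB.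
Qed.

Let envelope_dev_moments : [/\ measurable_fun [set: R] envelope_dev,
  F0.-integrable setT (EFin \o envelope_dev),
  F0.-integrable setT (EFin \o (fun u => envelope_dev u ^+ 2)) &
  \int[F0]_u envelope_dev u = 0].
Proof.
apply: (@centered_moments _ _ _ F0 envelope) => //.
  apply: (@integrable_normal_expR_center _ mu sigma a c 1) => // u.
  by rewrite mul1r ger0_norm ?expR_ge0.
apply: (@integrable_normal_expR_center _ mu sigma a (c * 2) 1) => //.
- by rewrite mulr_ge0.
- exact: measurable_funX.
move=> u; rewrite mul1r ger0_norm ?sqr_ge0// /envelope -expRM_natr.
by rewrite mulrAC.
Qed.

Let K0 : 0 < K.
Proof. by rewrite ltr_wpDl// Rintegral_ge0// => u _; exact: expR_ge0. Qed.

(** The three empirical means are those of the influence function, of the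
    information, and of the exponential envelope. *)
Lemma estimator_linearization (m delta : R) : 0 < m -> 0 < delta ->
  exists2 eps, 0 < eps & exists A, forall N w, (0 < N)%N -> A <= s N ->
    `|partial_sum phi x N w| < m * s N ->
    `|partial_sum info_dev x N w| < eps * N%:R ->
    `|partial_sum envelope_dev x N w| < N%:R ->
    `|s N * (beta N w - b) - partial_sum phi x N w / s N| <= delta.
Proof.
move=> m0 delta0.
have Jd : 0 < J * delta by rewrite mulr_gt0.
have md : 0 < m + delta by rewrite addr_gt0.
pose eps := Num.min (J * delta / 4 / (m + delta)) (J / 2).
have eps0 : 0 < eps by rewrite lt_min !divr_gt0.
exists eps => //.
pose Bt := \sum_(j < n) `|xt j - a|.
pose E := expR ((`|b| + 1) * Bt).
pose big := n%:R * (Bt * E) + n%:R * (n%:R * E + K) * K + (m + delta) ^+ 2 * K.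
have Bt0 : 0 <= Bt by rewrite sumr_ge0.
have E0 : 0 <= E by exact: expR_ge0.
have big0 : 0 <= big.
  have t1 : 0 <= n%:R * (Bt * E) by rewrite mulr_ge0// mulr_ge0.
  have t2 : 0 <= n%:R * (n%:R * E + K) * K.
    by rewrite mulr_ge0 ?(ltW K0)// mulr_ge0// addr_ge0 ?(ltW K0)// mulr_ge0.
  have t3 : 0 <= (m + delta) ^+ 2 * K := mulr_ge0 (sqr_ge0 _) (ltW K0).
  by rewrite addr_ge0// addr_ge0.
(* thresholds on sqrt N for the negligible terms and for the sign change *)
pose A1 := big * 4 / (J * delta); pose A2 := 4 * K * m / J + 1.
have A10 : 0 <= A1 by rewrite divr_ge0 ?mulr_ge0// ltW.
have A20 : 0 <= A2 by rewrite addr_ge0// divr_ge0 ?mulr_ge0 ?(ltW K0) ?(ltW m0) ?(ltW J0).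
exists (A1 + (m + delta) + A2) => N w N0 As h1 h2 h3.
have s0 : 0 < s N by rewrite sqrtr_gt0 ltr0n.
have NR : 0 < N%:R :> R by rewrite ltr0n.
have NR0 := lt0r_neq0 NR.
pose zt (j : 'I_n) := xt j - a; pose z i := x i w - a.
have zt0 : \sum_j zt j = 0.
  rewrite /zt sumrB sumr_const card_ord -mulr_natr /a /sample_mean divfK ?subrr//.
  by rewrite pnatr_eq0 -lt0n.
have HBt j : `|zt j| <= Bt.
  by rewrite /Bt (bigD1 j)//= lerDl sumr_ge0.
have phiE : partial_sum phi x N w / s N =
    - ((\sum_(i < N) z i * expR (b * z i)) / (J * s N)).
  rewrite /partial_sum /phi /influence sumrN mulNr -mulr_suml invfM mulrA.
  by [].
have HW : `|- ((\sum_(i < N) z i * expR (b * z i)) / (J * s N))| <= m.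
  by rewrite -phiE normrM normfV (gtr0_norm s0) ler_pdivrMr// ltW.
have HJ : `|(\sum_(i < N) z i ^+ 2 * expR (b * z i)) / N%:R - J| <= eps.
  have -> : (\sum_(i < N) z i ^+ 2 * expR (b * z i)) / N%:R - J =
      partial_sum info_dev x N w / N%:R.
    rewrite /partial_sum /info_dev sumrB mulrBl sumr_const card_ord
      -[X in _ = _ - X / _]mulr_natr.
    by rewrite mulfK.
  by rewrite normrM normfV (gtr0_norm NR) ler_pdivrMr// ltW.
have HK : \sum_(i < N) expR (c * `|z i|) <= K * N%:R.
  move: h3; rewrite /partial_sum /envelope_dev sumrB sumr_const card_ord ltr_norml.
  by rewrite -[X in _ < _ - X < _]mulr_natr /K /envelope /z => /andP[_ h3]; lra.
have small1 : (m + delta) * eps <= J * delta / 4.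
  by rewrite mulrC -ler_pdivlMr// ge_min lexx.
have small2 : eps <= J / 2 by rewrite ge_min lexx orbT.
have small3 : big <= J * delta / 4 * s N.
  have : A1 <= s N by lra.
  by rewrite /A1 ler_pdivrMr//; lra.
have small4 : m + delta <= s N by lra.
have small5 : K * m < J / 4 * s N.
  have : 4 * K * m / J < s N by rewrite /A2 in As; lra.
  by rewrite ltr_pdivrMr//; lra.
have EU := maximizer_exists_unique n0 N0 zt0 J0 K0 HK HW HJ small2 small5.
have mab := mle EU.
by rewrite phiE; exact: (maximizer_near n0 N0 HBt J0 delta0 K0 HK HW HJ
        small1 small3 small4 mab).
Qed.

Let V := asymptotic_variance F0 b a.
Let v := Num.sqrt V.

Let V0 : 0 < V.
Proof.
rewrite /V normal_asymptotic_variance// mulr_gt0 ?expR_gt0// divr_gt0 ?exprn_gt0//.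
by rewrite ltr_wpDl ?sqr_ge0// exprn_gt0.
Qed.

Let v0 : 0 < v. Proof. by rewrite sqrtr_gt0. Qed.
Let v2 : v ^+ 2 = V. Proof. by rewrite sqr_sqrtr// ltW. Qed.

Let near_sqrt (A : R) : \forall N \near \oo, A <= s N.
Proof.
have [N0 _ H] := nbhs_infty_ger (A ^+ 2).
exists N0 => // N N0N; have := H N N0N => /= AN.
by rewrite (le_trans (ler_norm A))// -sqrtr_sqr ler_wsqrtr.
Qed.

(** The first event only has small probability for large [m], uniformly in N; the
    two others become negligible by the weak law of large numbers. *)
Lemma bad_event_small (m eps e : R) : 0 < m -> 0 < eps -> 0 < e ->
  \forall N \near \oo,
  (P ([set w | (m * s N <= `|partial_sum phi x N w|)%R] `|`
    ([set w | (eps * N%:R <= `|partial_sum info_dev x N w|)%R] `|`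
     [set w | (N%:R <= `|partial_sum envelope_dev x N w|)%R])) <= (V / m ^+ 2 + e)%:E)%E.
Proof.
move=> m0 eps0 e0.
have [Iphi1 Iphi2 Iphi3] := @influence_integrable _ mu sigma b a sigma0.
have Ephi := @influence_mean0 _ mu sigma b a sigma0 ba.
have Vphi := @influence_variance _ mu sigma b a sigma0.
have mphi := @measurable_influence R mu sigma b a.
have [mpsi Ipsi1 Ipsi2 Epsi] := info_dev_moments.
have [mhH IhH1 IhH2 EhH] := envelope_dev_moments.
pose Vpsi := \int[F0]_u (info_dev u ^+ 2); pose VhH := \int[F0]_u (envelope_dev u ^+ 2).
have Vpsi0 : 0 <= Vpsi by apply: Rintegral_ge0 => u _; exact: sqr_ge0.
have VhH0 : 0 <= VhH by apply: Rintegral_ge0 => u _; exact: sqr_ge0.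
near=> N.
have N0 : (0 < N)%N by near: N; exact: nbhs_infty_gt.
have NR : 0 < N%:R :> R by rewrite ltr0n.
have s0 : 0 < s N by rewrite sqrtr_gt0.
have s2 : s N ^+ 2 = N%:R by rewrite sqr_sqrtr.
have mset (f : R -> R) k : measurable_fun [set: R] f ->
    measurable [set w | k <= `|partial_sum f x N w|].
  by move=> mf; apply: measurable_tail_set; exact: measurable_partial_sum.
have C1 := partial_sum_chebyshev iid mphi N Iphi1 Iphi2 Ephi Vphi (mulr_gt0 m0 s0).
have C2 := partial_sum_chebyshev iid mpsi N Ipsi1 Ipsi2 Epsi erefl (mulr_gt0 eps0 NR).
have C3 := partial_sum_chebyshev iid mhH N IhH1 IhH2 EhH erefl NR.
have N1 : (Vpsi / eps ^+ 2 + VhH) / e <= N%:R by near: N; exact: nbhs_infty_ger.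
have mP := mset _ _ mphi; have mQ := mset _ _ mpsi; have mR := mset _ _ mhH.
apply: (le_trans (measureU2 P (mP _) (measurableU _ _ (mQ _) (mR _)))).
apply: (@le_trans _ _ ((V / m ^+ 2)%:E + ((N%:R * Vpsi / (eps * N%:R) ^+ 2)%:E +
    (N%:R * VhH / N%:R ^+ 2)%:E))%E).
  apply: leeD.
    rewrite (_ : V / m ^+ 2 = N%:R * V / (m * s N) ^+ 2)//.
    by rewrite exprMn s2; field; rewrite !lt0r_neq0.
  by apply: (le_trans (measureU2 P (mQ _) (mR _))); exact: leeD.
rewrite -!EFinD lee_fin lerD2l.
have -> : N%:R * Vpsi / (eps * N%:R) ^+ 2 + N%:R * VhH / N%:R ^+ 2 =
    (Vpsi / eps ^+ 2 + VhH) / N%:R by field; rewrite !lt0r_neq0.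
by move: N1; rewrite !ler_pdivrMr// (mulrC e).
Unshelve. all: by end_near. Qed.

(** Three comparisons: the estimator with its linearization on the good event, the
    linearization with the Gaussian by the central limit theorem, and the smooth
    test function with [g] under the Gaussian law. *)
Lemma estimator_mean_near (g : R -> R) (Mg e : R) : continuous g -> 0 < Mg ->
  (forall y, `|g y| <= Mg) -> 0 < e ->
  \forall N \near \oo,
    `|\int[P]_w g (s N * (beta N w - b)) - \int[normal_prob 0 v]_u g u| <= e.
Proof.
move=> cg Mg0 gM e0.
have mg : measurable_fun [set: R] g by exact: continuous_measurable_fun.
pose e8 := e / 8; have e80 : 0 < e8 by rewrite divr_gt0.
(* m^2 >= q makes 2 Mg V / m^2 at most e8 *)
pose q := V * (2 * Mg) / e8; have q0 : 0 < q by rewrite divr_gt0// mulr_gt0// mulr_gt0.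
pose m := 1 + q; have m0 : 0 < m by rewrite addr_gt0.
have m2 : 2 * Mg * (V / m ^+ 2) <= e8.
  have qm : q <= m ^+ 2 by rewrite /m; nra.
  rewrite mulrA ler_pdivrMr ?exprn_gt0//.
  by move: qm; rewrite /q ler_pdivrMr//; lra.
have [K1 [f [f1 [f2 [delta [sf delta0 fM fg]]]]]] := smooth_approx cg gM m0 e80.
have [bf _ _ _] := sf; have mf := bounded_lipschitz_measurable bf.
have [eps eps0 [A HA]] := estimator_linearization m0 delta0.
have ep0 : 0 < e8 / (2 * Mg) by rewrite divr_gt0// mulr_gt0.
have [Iphi1 Iphi2 Iphi3] := @influence_integrable _ mu sigma b a sigma0.
have Ephi := @influence_mean0 _ mu sigma b a sigma0 ba.
have Vphi := @influence_variance _ mu sigma b a sigma0.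
have mphi := @measurable_influence R mu sigma b a.
rewrite -/F0 -/V -v2 in Vphi.
have [mpsi _ _ _] := info_dev_moments; have [mhH _ _ _] := envelope_dev_moments.
have normal_part : `|\int[normal_prob 0 v]_u f u - \int[normal_prob 0 v]_u g u| <=
    e8 + e8.
  have [_ G2 _ _ F2] := normal_moments v0.
  have EV : (\int[normal_prob 0 v]_u (u ^+ 2)%:E = V%:E)%E.
    rewrite -[LHS]fineK; last exact: integrable_fin_num G2.
    by rewrite -v2 -F2.
  have tail := second_moment_tail (P := normal_prob 0 v) (X := id)
    (@measurable_id _ _ setT) EV m0.
  have mB : measurable [set u : R | m <= `|u|].
    exact: (@measurable_tail_set _ _ _ id).
  have := @coupling_bound _ _ _ (normal_prob 0 v) f g _ Mg e8 _ mf mg mB fM gM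
    (ltW e80) _ tail.
  move=> h; apply: (le_trans (h _)); last by rewrite lerD2l.
  move=> u /negP; rewrite -ltNge => /ltW um; rewrite distrC; apply: fg => //.
  by rewrite subrr normr0 ltW.
pose C := K1 * (\int[F0]_u `|phi u| ^+ 3 + 2 * expR (9 / 2) * v ^+ 3).
near=> N.
have N0 : (0 < N)%N by near: N; exact: nbhs_infty_gt.
have s0 : 0 < s N by rewrite sqrtr_gt0 ltr0n.
have AN : A <= s N by near: N; exact: near_sqrt.
have CN : C / e8 <= s N by near: N; exact: near_sqrt.
have clt_part : `|\int[P]_w f (partial_sum phi x N w / s N) -
    \int[normal_prob 0 v]_u f u| <= e8.
  have := clt_smooth iid N.-1 mphi v0 Iphi1 Iphi2 Iphi3 Ephi Vphi sf.
  rewrite (prednK N0) => h; apply: (le_trans h).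
  by move: CN; rewrite !ler_pdivrMr// (mulrC e8).
have PB : (P ([set w | (m * s N <= `|partial_sum phi x N w|)%R] `|`
    ([set w | (eps * N%:R <= `|partial_sum info_dev x N w|)%R] `|`
     [set w | (N%:R <= `|partial_sum envelope_dev x N w|)%R])) <=
     (V / m ^+ 2 + e8 / (2 * Mg))%:E)%E.
  by near: N; exact: bad_event_small.
have mset (h : R -> R) k : measurable_fun [set: R] h ->
    measurable [set w | k <= `|partial_sum h x N w|].
  by move=> mh; apply: measurable_tail_set; exact: measurable_partial_sum.
have mB := measurableU _ _ (mset _ (m * s N) mphi)
  (measurableU _ _ (mset _ (eps * N%:R) mpsi) (mset _ N%:R mhH)).
have P_part : `|\int[P]_w g (s N * (beta N w - b)) -
    \int[P]_w f (partial_sum phi x N w / s N)| <= e8 + (e8 + e8).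
  apply: le_trans (@coupling_bound _ _ _ P _ _ _ Mg e8 _ _ _ mB _ _ _ _ PB) _ => //.
  - apply: (measurableT_comp mg); apply: measurable_funM => //.
    exact: measurable_funB.
  - apply: (measurableT_comp mf); apply: measurable_funM => //.
    exact: measurable_partial_sum.
  - exact: ltW.
  - move=> w /not_orP[/negP + /not_orP[/negP + /negP]].
    rewrite -!ltNge => h1 h2 h3; apply: fg.
      by rewrite normrM normfV (gtr0_norm s0) ler_pdivrMr// ltW.
    exact: HA.
  - rewrite lerD2l mulrDr lerD//.
    by rewrite mulrC divfK// mulf_neq0 ?lt0r_neq0.
have E : e8 + (e8 + e8) + e8 + (e8 + e8) = e - (e8 + e8) by rewrite /e8; field.
apply: (le_trans (ler_distD (\int[normal_prob 0 v]_u f u) _ _)).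
apply: (@le_trans _ _ (e8 + (e8 + e8) + e8 + (e8 + e8))).
  apply: lerD normal_part.
  by apply: (le_trans (ler_distD _ _ _)); exact: lerD P_part clt_part.
by rewrite E lerBlDr lerDl addr_ge0// ltW.
Unshelve. all: by end_near. Qed.

Lemma estimator_asymptotically_normal :
  cvg_in_distribution P (fun N w => s N * (beta N w - b)) (normal_prob 0 v).
Proof.
split => [N|g cg [M gM]].
  by apply: measurable_funM => //; exact: measurable_funB.
have mg : measurable_fun [set: R] g by exact: continuous_measurable_fun.
pose M1 := `|M| + 1.
have M10 : 0 < M1 by rewrite ltr_wpDl.
have gM1 y : `|g y| <= M1.
  by rewrite (le_trans (gM y))// (le_trans (ler_norm M))// lerDl.
have EE (d' : measure_display) (T' : measurableType d') (Q : probability T' R)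
    (X : T' -> R) : measurable_fun [set: T'] X ->
    ('E_Q[g \o X] = (\int[Q]_w g (X w))%:E)%E.
  move=> mX; rewrite unlock /Rintegral fineK//.
  apply: integrable_fin_num => //; apply: (@integrable_bounded _ _ _ Q _ M1) => //.
  exact: (measurableT_comp mg).
rewrite (EE _ _ (normal_prob 0 v) id)//.
rewrite (_ : (fun N => 'E_P[g \o (fun w => (s N * (beta N w - b))%R)])%E =
    (fun N => (\int[P]_w g (s N * (beta N w - b)))%:E)); last first.
  apply/funext => N; apply: EE.
  by apply: measurable_funM => //; exact: measurable_funB.
apply: cvg_EFin; first by near=> N.
apply/cvgrPdist_le => e e0; near=> N; rewrite distrC /=.
by near: N; exact: (estimator_mean_near cg M10 gM1 e0).
Unshelve. all: by end_near. Qed.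

End asymptotic_normality.



Theorem corollary1 (R : realType) (d : measure_display) (T : measurableType d)
    (P : probability T R) (mu sigma : R) (n : nat) (xt : 'I_n -> R) (C : R)
    (x : nat -> {RV P >-> R}) (betastar : R)
    (alpha : nat -> T -> R) (beta : nat -> {RV P >-> R}) :
  let F0 : probability (measurableTypeR R) R := normal_prob mu sigma in
  let xbar := sample_mean xt in
  0 < sigma ->
  (0 < n)%N ->
  \big[Num.max/0]_(j < n) `|xt j| < C ->
  iid_from x F0 ->
  (forall (b : R) (k : nat), (1 <= k <= 2)%N ->
     (\int[F0]_u (expR (b * u) * (1 + `|u| ^+ k))%:E < +oo)%E) ->
  surrounds F0 xbar ->
  unique (fun b => tilted_mean F0 b = xbar) betastar ->
  (0 < 'E_F0[(fun u : R => expR (betastar * u) * (u - xbar) ^+ 2)%R])%E ->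
  (forall (N : nat) (w : T),
     let L := centered_loglik xt N (fun i => x i w) in
     (exists! ab : R * R, maximizes L ab) ->
     maximizes L (alpha N w, beta N w)) ->
  let Sigma := asymptotic_variance F0 betastar xbar in
  cvg_in_distribution P
    (fun (N : nat) (w : T) => Num.sqrt N%:R * (beta N w - betastar))
    (normal_prob 0 (Num.sqrt Sigma)) /\
  Sigma = expR ((xbar - mu) ^+ 2 / sigma ^+ 2) *
            (((xbar - mu) ^+ 2 + sigma ^+ 2) / sigma ^+ 4).
Proof.
move=> F0 xbar sigma0 n0 _ iid _ _ [tm _] _ mle Sigma.
have ba : mu + sigma ^+ 2 * betastar = xbar.
  by rewrite -tm /F0 normal_tilted_mean.
split; last exact: normal_asymptotic_variance.
exact: (estimator_asymptotically_normal sigma0 n0 iid ba mle).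
Qed.
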